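(* Let $\mathbf K^1$ and $\mathbf K^2$ be fragmented AECs with $\mathrm{dom}(\mathbf K^1) = \mathrm{dom}(\mathbf K^2) =: \Theta$ and $\mathrm{LS}(\mathbf K^1) = \mathrm{LS}(\mathbf K^2)$. Suppose that for $\ell = 1,2$, $\mathbf K^\ell$ has the amalgamation property and is stable and categorical in every $\lambda \in \Theta$. If $\mathbf K^1_{\le \mathrm{LS}(\mathbf K^1)} = \mathbf K^2_{\le \mathrm{LS}(\mathbf K^2)}$ (same models and same ordering), then $\mathbf K^1 = \mathbf K^2$.
   Context: An abstract class $\mathbf K=(K,\le_{\mathbf K})$ is a class of structures in a fixed vocabulary $\tau(\mathbf K)$, closed under isomorphism, with a partial order extending substructure and invariant under isomorphism. $\mathrm{LS}(\mathbf K)$ is the least $\lambda\ge|\tau(\mathbf K)|+\aleph_0$ such that every $A\subseteq|M|$, $M\in\mathbf K$, is contained in some $M_0\le_{\mathbf K} M$ with $\|M_0\|\le|A|+\lambda$. A fragmented AEC is an abstract class with $\mathrm{LS}(\mathbf K)<\infty$ satisfying: coherence; restricted chain axiom (if $\langle M_i:i<\delta\rangle$ is increasing, $M_\delta=\bigcup_i M_i$, and $\|M_i\|=\|M_\delta\|$ for some $i<\delta$, then $M_\delta\in\mathbf K$ and $M_0\le_{\mathbf K}M_\delta$); smoothness (if $\langle M_i:i<\delta\rangle$ is increasing and $M_i\le_{\mathbf K}N$ for all $i$, then $\bigcup_i M_i\in\mathbf K$ and $\bigcup_i M_i\le_{\mathbf K}N$). $\mathrm{dom}(\mathbf K)$ is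 the class of cardinals $\lambda$ with a model of cardinality $\lambda$; $\mathbf K_{\le\lambda}$ is the class of models of cardinality $\le\lambda$ with the restricted order. Stable in $\lambda$: every model of cardinality $\lambda$ has at most $\lambda$ orbital (Galois) types over it. Categorical in $\lambda$: exactly one model of cardinality $\lambda$ up to isomorphism. *)

(* Defs.v *)
Definition arg (n : nat) : Type := {i : nat | i < n}.

Record vocab := {
  fsym : Type; rsym : Type;
  farity : fsym -> nat; rarity : rsym -> nat }.

(** A tau-structure "living in" the ambient type U: its universe is the
    subset [sdom] of U.  Values of the interpretations outside [sdom] are
    irrelevant junk (all notions below only look at [sdom]). *)
Record structure (tau : vocab) (U : Type) := {
  sdom : U -> Prop;
  sfun : forall f : fsym tau, (arg (farity tau f) -> U) -> U;
  srel : forall r : rsym tau, (arg (rarity tau r) -> U) -> Prop;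
  sclosed : forall f xs, (forall i, sdom (xs i)) -> sdom (sfun f xs) }.

Set Implicit Arguments.
Unset Strict Implicit.
Arguments sdom {tau U} s _.
Arguments sfun {tau U} s f _.
Arguments srel {tau U} s r _.

Section Defs.
Variable tau : vocab.

Definition substructure {U} (M N : structure tau U) : Prop :=
  (forall x, sdom M x -> sdom N x) /\
  (forall f xs, (forall i, sdom M (xs i)) -> sfun M f xs = sfun N f xs) /\
  (forall r xs, (forall i, sdom M (xs i)) -> (srel M r xs <-> srel N r xs)).

Definition iso {U V} (f : U -> V) (M : structure tau U) (N : structure tau V) : Prop :=
  (forall x, sdom M x -> sdom N (f x)) /\
  (forall x y, sdom M x -> sdom M y -> f x = f y -> x = y) /\
  (forall y, sdom N y -> exists x, sdom M x /\ f x = y) /\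
  (forall s xs, (forall i, sdom M (xs i)) ->
      f (sfun M s xs) = sfun N s (fun i => f (xs i))) /\
  (forall r xs, (forall i, sdom M (xs i)) ->
      (srel M r xs <-> srel N r (fun i => f (xs i)))).

End Defs.

(** Cardinal comparison of subsets (|A| <= |B|, |A| = |B|). Cardinals are
    represented by types (or subsets of types). *)
Definition card_le {U V} (A : U -> Prop) (B : V -> Prop) : Prop :=
  exists g : U -> V, (forall x, A x -> B (g x)) /\
    (forall x y, A x -> A y -> g x = g y -> x = y).
Definition card_eq {U V} (A : U -> Prop) (B : V -> Prop) : Prop :=
  card_le A B /\ card_le B A.
Definition full (L : Type) : L -> Prop := fun _ => True.
Arguments full L _ : clear implicits.
Definition sumP {U V} (A : U -> Prop) (B : V -> Prop) : U + V -> Prop :=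
  fun z => match z with inl x => A x | inr y => B y end.

Record aclass (tau : vocab) := {
  inK : forall U, structure tau U -> Prop;
  leK : forall U, structure tau U -> structure tau U -> Prop }.
Arguments inK {tau} _ {U} _.
Arguments leK {tau} _ {U} _ _.

Section AEC.
Variable tau : vocab.
Variable C : aclass tau.

Definition is_abstract_class : Prop :=
  (forall U V (M : structure tau U) (N : structure tau V) f,
      inK C M -> iso f M N -> inK C N) /\
  (forall U (M N : structure tau U), leK C M N ->
      inK C M /\ inK C N /\ substructure M N) /\
  (forall U (M : structure tau U), inK C M -> leK C M M) /\
  (forall U (M N P : structure tau U), leK C M N -> leK C N P -> leK C M P) /\
  (forall U V (M N : structure tau U) (M' N' : structure tau V) f,
      leK C M N -> iso f N N' -> iso f M M' -> leK C M' N').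

Definition LS_prop (L : Type) : Prop :=
  (exists e : nat -> L, forall n m, e n = e m -> n = m) /\
  card_le (full (fsym tau + rsym tau)%type) (full L) /\
  (forall U (M : structure tau U) (A : U -> Prop),
      inK C M -> (forall x, A x -> sdom M x) ->
      exists M0, leK C M0 M /\ (forall x, A x -> sdom M0 x) /\
                 card_le (sdom M0) (sumP A (full L))).

Definition is_LS (L : Type) : Prop :=
  LS_prop L /\ forall L' : Type, LS_prop L' -> card_le (full L) (full L').

(** index types for chains: limit ordinals (well-ordered, nonempty, no max) *)
Definition limit_wo {I : Type} (lt : I -> I -> Prop) : Prop :=
  well_founded lt /\
  (forall i j k, lt i j -> lt j k -> lt i k) /\
  (forall i j, lt i j \/ i = j \/ lt j i) /\
  inhabited I /\
  (forall i, exists j, lt i j).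

Definition increasing_chain {I U} (lt : I -> I -> Prop) (M : I -> structure tau U) :=
  (forall i, inK C (M i)) /\ (forall i j, lt i j -> leK C (M i) (M j)).

Definition is_union {I U} (M : I -> structure tau U) (Md : structure tau U) :=
  (forall x, sdom Md x <-> exists i, sdom (M i) x) /\
  (forall i, substructure (M i) Md).

Definition coherence : Prop :=
  forall U (M0 M1 M2 : structure tau U),
    inK C M0 -> inK C M1 -> inK C M2 -> substructure M0 M1 ->
    leK C M0 M2 -> leK C M1 M2 -> leK C M0 M1.

Definition restricted_chain_axiom : Prop :=
  forall (I : Type) (lt : I -> I -> Prop) U (M : I -> structure tau U) Md,
    limit_wo lt -> increasing_chain lt M -> is_union M Md ->
    (exists i, card_eq (sdom (M i)) (sdom Md)) ->
    inK C Md /\ (forall i0, (forall j, ~ lt j i0) -> leK C (M i0) Md).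

Definition smoothness : Prop :=
  forall (I : Type) (lt : I -> I -> Prop) U (M : I -> structure tau U) Md N,
    limit_wo lt -> increasing_chain lt M -> is_union M Md ->
    (forall i, leK C (M i) N) -> inK C Md /\ leK C Md N.

Definition fragmented_AEC : Prop :=
  is_abstract_class /\ (exists L : Type, LS_prop L) /\
  coherence /\ restricted_chain_axiom /\ smoothness.

Definition kemb {U V} (f : U -> V) (M : structure tau U) (N : structure tau V) :=
  exists M' : structure tau V, iso f M M' /\ leK C M' N.

Definition amalgamation : Prop :=
  forall U (M N1 N2 : structure tau U), leK C M N1 -> leK C M N2 ->
    exists V (N : structure tau V) (g1 g2 : U -> V),
      kemb g1 N1 N /\ kemb g2 N2 N /\ (forall x, sdom M x -> g1 x = g2 x).

Definition in_dom (L : Type) : Prop :=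
  exists U (M : structure tau U), inK C M /\ card_eq (sdom M) (full L).

(** Orbital (Galois) types over M: triples (M, a, N) with M <=_K N, a in N,
    where N is given up to renaming via a K-embedding f : M -> N. *)
Record gtriple (U : Type) := {
  tV : Type; tN : structure tau tV; tf : U -> tV; ta : tV }.

Definition valid_triple {U} (M : structure tau U) (t : gtriple U) : Prop :=
  kemb (tf t) M (tN t) /\ sdom (tN t) (ta t).

Definition E_at {U} (M : structure tau U) (t1 t2 : gtriple U) : Prop :=
  exists W (N : structure tau W) (g1 : tV t1 -> W) (g2 : tV t2 -> W),
    kemb g1 (tN t1) N /\ kemb g2 (tN t2) N /\
    (forall x, sdom M x -> g1 (tf t1 x) = g2 (tf t2 x)) /\
    g1 (ta t1) = g2 (ta t2).

Inductive gal_eq {U} (M : structure tau U) : gtriple U -> gtriple U -> Prop :=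
  | gal_step t1 t2 : valid_triple M t1 -> valid_triple M t2 ->
      E_at M t1 t2 -> gal_eq M t1 t2
  | gal_trans t1 t2 t3 : gal_eq M t1 t2 -> gal_eq M t2 t3 -> gal_eq M t1 t3.

Definition stable_in (L : Type) : Prop :=
  forall U (M : structure tau U), inK C M -> card_eq (sdom M) (full L) ->
    exists h : gtriple U -> L, forall t1 t2,
      valid_triple M t1 -> valid_triple M t2 -> h t1 = h t2 -> gal_eq M t1 t2.

Definition categorical_in (L : Type) : Prop :=
  in_dom L /\
  forall U V (M : structure tau U) (N : structure tau V),
    inK C M -> inK C N -> card_eq (sdom M) (full L) -> card_eq (sdom N) (full L) ->
    exists f : U -> V, iso f M N.

End AEC.

Definition same_below {tau} (K1 K2 : aclass tau) (L : Type) : Prop :=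
  (forall U (M : structure tau U), card_le (sdom M) (full L) ->
     (inK K1 M <-> inK K2 M)) /\
  (forall U (M N : structure tau U),
     card_le (sdom M) (full L) -> card_le (sdom N) (full L) ->
     (leK K1 M N <-> leK K2 M N)).

Definition same_class {tau} (K1 K2 : aclass tau) : Prop :=
  (forall U (M : structure tau U), inK K1 M <-> inK K2 M) /\
  (forall U (M N : structure tau U), leK K1 M N <-> leK K2 M N).

(* Main.v *)
Require Import Defs.
From mathcomp Require Import ssreflect ssrfun ssrbool eqtype.
From mathcomp Require Import boolp.
From mathcomp Require classical_sets wochoice.
From Stdlib Require Import Classical ClassicalEpsilon FunctionalExtensionality.
From Stdlib Require Import PropExtensionality Cantor.

(** By induction on a cardinal L > LS, the two classes agree on models of size
    at most L.  By stability in L, a chain of models of size L, each realizing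
    all types over its predecessors, can be built of length n^+ for any n with
    LS <= n < L.  As the chain has constant cardinality, the restricted chain
    axiom applies; its union is saturated for types over submodels of size n,
    hence homogeneous for extensions of size n, and categoricity in L carries
    this to every model of size L.  Models of size L in the two classes are
    homogeneous over the same class of smaller models, so a back-and-forth along
    L makes them isomorphic, whence the models of size L are the same.

    For the orders, let M <= N in the first class.  If M is smaller than N,
    alternating Loewenheim-Skolem hulls gives a small submodel of N containing M
    that is strong in N for both orders, so the induction hypothesis applies.
    If both have size L, resolve M into a chain of small submodels; each is
    strong in N for the second order, and smoothness gives M <= N there. *)

Set Implicit Arguments.
Unset Strict Implicit.
Unset Printing Implicit Defensive.

(** * Cardinals *)

(** The obstacle is that a fragmented AEC need not be closed under unions of chains whose members
    grow in cardinality. Every union of models below is therefore of one of two kinds: the members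
    are strong in one fixed model, so that smoothness applies, or some member is as large as the
    union, so that the restricted chain axiom applies. This is why homogeneity goes through types:
    the extension to be embedded is enlarged at constant size [n], while its partial copy grows
    inside the given model. In the back-and-forth the stages are smaller than [L], but they lie in
    [M] and their images in [N].

    A second constraint is that [leK] compares structures on one ambient type. Chains of extensions
    of size [L] are built in [L -> Prop], where the complement of a set of size at most |L| has size
    at least |L|: each extension can be renamed without moving the model that it extends.

    The length n^+ is chosen because every subset of size n is bounded in it, while n < L gives n^+
    <= L, so that the union still has size |L|. *)

Lemma predext {T} (P Q : T -> Prop) : (forall x, P x <-> Q x) -> P = Q.
Proof.
move=> h; apply: functional_extensionality => x.
exact: propositional_extensionality.
Qed.

Lemma choice_on {A B : Type} (D : A -> Prop) (R : A -> B -> Prop) (b : B) :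
  (forall x, D x -> exists y, R x y) -> exists f, forall x, D x -> R x (f x).
Proof.
move=> h.
exists (fun x => epsilon (inhabits b) (R x)) => x /h; exact: epsilon_spec.
Qed.

Lemma zorn_sets (T : Type) (P : (T -> Prop) -> Prop) :
  (forall F : (T -> Prop) -> Prop, (forall X, F X -> P X) ->
    (forall X Y, F X -> F Y ->
       (forall x, X x -> Y x) \/ (forall x, Y x -> X x)) ->
    P (fun x => exists X, F X /\ X x)) ->
  exists A, P A /\ forall B, (forall x, A x -> B x) -> P B -> forall x, B x -> A x.
Proof.
move=> h; have [|A [PA mA]] := @classical_sets.Zorn_bigcup T P.
  move=> F FP tF.
  have -> : classical_sets.bigcup F id = (fun x => exists X, F X /\ X x).
    by apply: predext => x; split=> [[X ? ?]|[X [? ?]]]; exists X.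
  exact: h.
exists A; split=> // B AB PB; apply: NNPP => nBA.
exact: (mA B _ PB).
Qed.

(* Hönig's argument: in a maximal set of pairwise everywhere-distinct sections,
   some projection is onto, and the fibre there embeds in all others. *)
Lemma minimal_cardinal (S : Type) (s0 : S) (X : S -> Type) :
  exists s, forall t, card_le (full (X s)) (full (X t)).
Proof.
pose P (F : (forall s, X s) -> Prop) :=
  forall p q, F p -> F q -> (exists s, p s = q s) -> p = q.
have [|A [PA mA]] := @zorn_sets _ P.
  move=> F FP tF p q [Y [FY Yp]] [Z [FZ Zq]] e.
  case: (tF _ _ FY FZ) => sub; first by apply: (FP Z) => //; exact: sub.
  by apply: (FP Y) => //; exact: sub.
have [s hs] : exists s, forall x : X s, exists p, A p /\ p s = x.
  apply: NNPP => hn.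
  have hx s : exists x : X s, forall p, A p -> p s <> x.
    apply: NNPP => h1; apply: hn; exists s => x; apply: NNPP => h2.
    by apply: h1; exists x => p Ap e; apply: h2; exists p.
  pose p0 s := proj1_sig (constructive_indefinite_description _ (hx s)).
  have hp0 s p : A p -> p s <> p0 s.
    by rewrite /p0; case: constructive_indefinite_description => x /= h /h.
  have : A p0.
    apply: (mA (fun p => A p \/ p = p0)); [by left| |by right].
    move=> p q [Ap|->] [Aq|->] [s e] //; first by apply: PA => //; exists s.
      by case: (hp0 s p).
    by case: (hp0 s q).
  by move=> /(hp0 s0).
exists s => t.
have hf x := proj2_sig (constructive_indefinite_description _ (hs x)).
exists (fun x => proj1_sig (constructive_indefinite_description _ (hs x)) t).
split=> // x y _ _ e.
have [Ax <-] := hf x; have [Ay <-] := hf y.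
by congr (_ s); apply: PA => //; exists t.
Qed.

Lemma card_le_refl {U} (A : U -> Prop) : card_le A A.
Proof. by exists id; split. Qed.

Lemma card_le_trans {U V W} (A : U -> Prop) (B : V -> Prop) (C : W -> Prop) :
  card_le A B -> card_le B C -> card_le A C.
Proof.
move=> [f [fB fi]] [g [gC gi]]; exists (fun x => g (f x)); split.
  by move=> x /fB /gC.
by move=> x y Ax Ay /gi e; apply: fi => //; apply: e; exact: fB.
Qed.

Lemma card_le_sub {U} (A B : U -> Prop) : (forall x, A x -> B x) -> card_le A B.
Proof. by move=> s; exists id; split. Qed.

Lemma card_le_full {U V} (A : U -> Prop) (B : V -> Prop) :
  card_le A B -> card_le A (full V).
Proof. by move=> [f [? ?]]; exists f; split. Qed.

Lemma sig_inj {U} {A : U -> Prop} (x y : sig A) : proj1_sig x = proj1_sig y -> x = y.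
Proof.
case: x y => x Ax [y Ay] /= e; case: _ / e Ay => Ay; congr exist.
exact: proof_irrelevance.
Qed.

Lemma card_sig_le {U} (A : U -> Prop) : card_le (full (sig A)) A.
Proof.
exists (@proj1_sig _ _); split=> [[]|] // x y _ _; exact: sig_inj.
Qed.

Lemma card_le_of_sig {U V} (A : U -> Prop) (B : V -> Prop) (v : V) :
  card_le (full (sig A)) B -> card_le A B.
Proof.
move=> [f [fB fi]].
exists (fun x => match excluded_middle_informative (A x) with
             | left h => f (exist _ x h) | right _ => v end); split.
  by move=> x Ax; case: excluded_middle_informative => // h; exact: fB.
move=> x y Ax Ay; case: excluded_middle_informative => // h1.
case: excluded_middle_informative => // h2 /fi e.
by have := e I I => /(congr1 (@proj1_sig _ _)).
Qed.

Lemma card_le_sig {U} (A : U -> Prop) a : A a -> card_le A (full (sig A)).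
Proof. by move=> Aa; apply: card_le_of_sig; [exists a|exact: card_le_refl]. Qed.

Lemma card_le_total_type (X Y : Type) :
  card_le (full X) (full Y) \/ card_le (full Y) (full X).
Proof.
have [[] h] := minimal_cardinal true (fun b : bool => if b then X else Y).
  by left; exact: (h false).
by right; exact: (h true).
Qed.

Lemma card_le_total {U V} (A : U -> Prop) (B : V -> Prop) (u : U) (v : V) :
  card_le A B \/ card_le B A.
Proof.
case: (card_le_total_type (sig A) (sig B)) => h; [left|right].
  by apply: card_le_of_sig => //; exact: card_le_trans h (card_sig_le _).
by apply: card_le_of_sig => //; exact: card_le_trans h (card_sig_le _).
Qed.

Lemma card_le_not {U V} (A : U -> Prop) (B : V -> Prop) (u : U) (v : V) :
  ~ card_le A B -> card_le B A.
Proof. by case: (card_le_total A B u v). Qed.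

(** [minimal_cardinal] needs a family indexed by a type. Cardinals up to that of [X0] are
    represented by subsets of [X0], so the counterexamples among them are indexed by [S], and a
    least one contradicts the hypothesis. *)
Lemma card_induction (P : Type -> Prop) :
  (forall X, (forall Y, card_le (full Y) (full X) ->
                ~ card_le (full X) (full Y) -> P Y) -> P X) ->
  forall X, P X.
Proof.
move=> hP X0; apply: NNPP => nP.
pose S := {D : X0 -> Prop | exists Y : Type, ~ P Y /\
             card_le (full Y) (full (sig D)) /\ card_le (full (sig D)) (full Y)}.
have mkS Z : ~ P Z -> card_le (full Z) (full X0) ->
    exists s : S, card_le (full (sig (proj1_sig s))) (full Z).
  move=> nZ [f [_ fi]].
  have h1 : card_le (full (sig (fun x => exists z, f z = x))) (full Z).
    have hz (x : sig (fun x => exists z, f z = x)) : exists z, f z = proj1_sig x.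
      by case: x.
    have [k hk] := choice _ hz; exists k; split=> // x y _ _ e.
    by apply: sig_inj; rewrite -!hk e.
  unshelve eexists (exist _ (fun x => exists z, f z = x) _); last by [].
  exists Z; split=> //; split=> //.
  exists (fun z => exist _ (f z) (ex_intro _ z erefl)); split=> // x y _ _ [].
  exact: fi.
have [s0 _] := mkS X0 nP (card_le_refl _).
have [[D [Y [nY [YD DY]]]] /= hD] := minimal_cardinal s0 (fun s : S => sig (proj1_sig s)).
apply: nY; apply: hP => Z ZY nYZ; apply: NNPP => nZ.
have /= DX : card_le (full (sig D)) (full X0).
  exact: card_le_full (card_sig_le _).
have [t tZ] := mkS Z nZ (card_le_trans ZY (card_le_trans YD DX)).
apply: nYZ; apply: card_le_trans tZ; apply: card_le_trans (hD t); exact: YD.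
Qed.

(** * Squares, sums and unions of infinite cardinals *)

Definition infinite (L : Type) := exists e : nat -> L, forall n m, e n = e m -> n = m.

(** Zorn's lemma on injections B x B -> B with B a subset of [L], coded by their graphs [G]; B is
    the set [Bd G] of points whose diagonal pair has a value. For a maximal one, either the
    complement of B embeds in B, so that [L] embeds in B and the square follows, or B embeds in its
    complement and the injection can be extended. *)
Lemma square_le (L : Type) : infinite L -> card_le (full (L * L)) (full L).
Proof.
move=> [e ei].
pose Bd (G : L * L * L -> Prop) x := exists z, G (x, x, z).
pose ok G :=
  [/\ forall a b c c', G (a, b, c) -> G (a, b, c') -> c = c',
      forall a b a' b' c, G (a, b, c) -> G (a', b', c) -> a = a' /\ b = b',
      forall a b c, G (a, b, c) -> [/\ Bd G a, Bd G b & Bd G c]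
    & forall a b, Bd G a -> Bd G b -> exists c, G (a, b, c)].
pose G0 (t : L * L * L) := exists n m, t = (e n, e m, e (to_nat (n, m))).
have cinj n m n' m' : to_nat (n, m) = to_nat (n', m') -> n = n' /\ m = m'.
  by move=> h; have := cancel_of_to (n, m); rewrite h cancel_of_to => -[-> ->].
have BG0 n : Bd G0 (e n) by exists (e (to_nat (n, n))), n, n.
have ok0 : ok G0.
  split.
  - by move=> a b c c' [n [m [-> -> ->]]] [n' [m' [/ei <- /ei <- ->]]].
  - by move=> a b a' b' c [n [m [-> -> ->]]] [n' [m' [-> -> /ei /cinj [-> ->]]]].
  - by move=> a b c [n [m [-> -> ->]]].
  - move=> a b [z [n [m [-> _ _]]]] [z' [n' [m' [-> _ _]]]].
    by exists (e (to_nat (n, n'))), n, n'.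
(* Adding the countable [G0] to every member makes the union of the empty chain admissible, and puts
   the range of [e] into B, where its points serve as tags. *)
pose U0 (G : L * L * L -> Prop) t := G t \/ G0 t.
have [|A [okA mA]] := @zorn_sets _ (fun G => ok (U0 G)).
  move=> F Fok tF.
  set UF := U0 _.
  pose mem H := H = G0 \/ exists X, F X /\ H = U0 X.
  have mok H : mem H -> ok H by move=> [->|[X [/Fok ? ->]]].
  have msub H t : mem H -> H t -> UF t.
    by move=> [->|[X [FX ->]]] => [|[]]; [right|left; exists X|right].
  have mBd H x : mem H -> Bd H x -> Bd UF x.
    by move=> mH [z Hz]; exists z; exact: msub Hz.
  have m1 t : UF t -> exists H, mem H /\ H t.
    move=> [[X [FX Xt]]|Gt]; last by exists G0; split=> //; left.
    by exists (U0 X); split; [right; exists X|left].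
  have m2 t t' : UF t -> UF t' -> exists H, [/\ mem H, H t & H t'].
    move=> /m1 [H [[->|[X [FX ->]]] Ht]] /m1 [H' [[->|[X' [FX' ->]]] Ht']].
    - by exists G0; split=> //; left.
    - by exists (U0 X'); split=> //; [right; exists X'|right].
    - by exists (U0 X); split=> //; [right; exists X|right].
    - case: (tF _ _ FX FX') => s.
        exists (U0 X'); split=> //; first by right; exists X'.
        by case: Ht => [/s|]; [left|right].
      exists (U0 X); split=> //; first by right; exists X.
      by case: Ht' => [/s|]; [left|right].
  split.
  - move=> a b c c' h h'; have [H [/mok [f _ _ _] Ht Ht']] := m2 _ _ h h'.
    exact: f Ht Ht'.
  - move=> a b a' b' c h h'; have [H [/mok [_ f _ _] Ht Ht']] := m2 _ _ h h'.
    exact: f Ht Ht'.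
  - move=> a b c /m1 [H [mH Ht]]; have [_ _ /(_ _ _ _ Ht) [? ? ?] _] := mok _ mH.
    by split; apply: (mBd H).
  - move=> a b [z h] [z' h']; have [H [mH Ht Ht']] := m2 _ _ h h'.
    have [_ _ _ /(_ a b) []] := mok _ mH; [by exists z|by exists z'|].
    by move=> c /(msub _ _ mH) ?; exists c.
set G := U0 A in okA; have [Gf Gi Gd Gt] := okA.
have mG G' : (forall t, G t -> G' t) -> ok G' -> forall t, G' t -> G t.
  move=> s ok' t G't; left; apply: (mA G') => // [x Ax|].
    by apply: s; left.
  suff -> : U0 G' = G' by [].
  apply: predext => x; split=> [[]|]; [by []| |by left].
  by move=> h; apply: s; right.
have Be n : Bd G (e n) by have [z h] := BG0 n; exists z; right.
have [g hg] : exists g : L * L -> L, forall p, Bd G p.1 /\ Bd G p.2 -> G (p.1, p.2, g p).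
  apply: (@choice_on _ _ (fun p => Bd G p.1 /\ Bd G p.2)
            (fun p z => G (p.1, p.2, z)) (e 0)) => -[a b] /= [ha hb].
  exact: Gt.
have gB a b : Bd G a -> Bd G b -> Bd G (g (a, b)).
  by move=> ha hb; have [_ _] := Gd _ _ _ (hg (a, b) (conj ha hb)).
have gi a b a' b' : Bd G a -> Bd G b -> Bd G a' -> Bd G b' ->
    g (a, b) = g (a', b') -> a = a' /\ b = b'.
  move=> ha hb ha' hb' eq; apply: Gi (hg (a, b) (conj ha hb)) _.
  by rewrite eq; exact: (hg (a', b') (conj ha' hb')).
have en n m : n <> m -> e n <> e m by move=> nm /ei.
case: (card_le_total (Bd G) (fun x => ~ Bd G x) (e 0) (e 0)) => -[h [hB hi]]; last first.
  (* Here [h] embeds the complement of B in B; the tags [e 0] and [e 1] keep the two halves of [L]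
     apart. *)
  pose k x := if excluded_middle_informative (Bd G x) then g (e 0, x) else g (e 1, h x).
  have kB x : Bd G (k x).
    rewrite /k; case: excluded_middle_informative => b; apply/gB => //; exact: hB.
  have ki x y : k x = k y -> x = y.
    rewrite /k; case: excluded_middle_informative => bx;
      case: excluded_middle_informative => by_ /gi.
    - by move=> /(_ (Be _) bx (Be _) by_) [].
    - by move=> /(_ (Be _) bx (Be _) (hB _ by_)) [/ei].
    - by move=> /(_ (Be _) (hB _ bx) (Be _) by_) [/ei].
    - by move=> /(_ (Be _) (hB _ bx) (Be _) (hB _ by_)) [_ /hi]; apply.
  exists (fun p => g (k p.1, k p.2)); split=> // -[x1 x2] [y1 y2] _ _ /= /gi.
  by move=> /(_ (kB _) (kB _) (kB _) (kB _)) [/ki -> /ki ->].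
(* Here [h] embeds B in its complement. Passing from B to the union of B and h(B) adds three blocks
   to the square; the tags [e 0], [e 1], [e 2] give them disjoint ranges inside h(B), apart from the
   old values, which lie in B. *)
pose N x y z := exists u v, [/\ Bd G u, Bd G v &
  [\/ [/\ x = h u, y = v & z = h (g (e 0, g (u, v)))],
      [/\ x = u, y = h v & z = h (g (e 1, g (u, v)))]
    | [/\ x = h u, y = h v & z = h (g (e 2, g (u, v)))]]].
pose G' (t : L * L * L) := G t \/ N t.1.1 t.1.2 t.2.
have hN u : Bd G u -> Bd G (h u) -> False by move=> bu; exact: hB.
have Bd'1 x : Bd G x -> Bd G' x by move=> [z ?]; exists z; left.
have Bd'2 x : Bd G x -> Bd G' (h x).
  move=> bx; exists (h (g (e 2, g (x, x)))); right; exists x, x; split=> //.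
  by apply: Or33.
have Bd' x : Bd G' x -> Bd G x \/ exists u, Bd G u /\ x = h u.
  move=> [z [?|[u [v [bu bv]]]]]; first by left; exists z.
  by move=> [[/= -> _ _]|[/= -> _ _]|[/= -> _ _]]; [right; exists u|left|right; exists u].
have hgi n m u v u' v' : Bd G u -> Bd G v -> Bd G u' -> Bd G v' ->
    h (g (e n, g (u, v))) = h (g (e m, g (u', v'))) -> [/\ n = m, u = u' & v = v'].
  move=> bu bv bu' bv' eq.
  have [| | | | |/ei -> eq'] := gi (e n) (g (u, v)) (e m) (g (u', v')); try by do ?apply/gB.
    by apply: hi eq; apply/gB => //; exact: gB.
  by have [-> ->] := gi _ _ _ _ bu bv bu' bv' eq'.
have okG' : ok G'.
  split.
  - move=> a b c c' [h1|[u [v [bu bv h1]]]] [h2|[u' [v' [bu' bv' h2]]]] /=.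
    + exact: Gf h1 h2.
    + have [ba bb _] := Gd _ _ _ h1.
      case: h2 => /= -[ea eb _]; subst; by [case: (hN u')|case: (hN v')].
    + have [ba bb _] := Gd _ _ _ h2.
      case: h1 => /= -[ea eb _]; subst; by [case: (hN u)|case: (hN v)].
    + case: h1 => /= -[ea eb ->]; case: h2 => /= -[ea' eb' ->]; subst.
      * by rewrite (hi _ _ bu bu' ea').
      * by case: (hN u).
      * by case: (hN v').
      * by case: (hN u').
      * by rewrite (hi _ _ bv bv' eb').
      * by case: (hN u').
      * by case: (hN v).
      * by case: (hN u).
      * by rewrite (hi _ _ bv bv' eb') (hi _ _ bu bu' ea').
  - move=> a b a' b' c [h1|[u [v [bu bv h1]]]] [h2|[u' [v' [bu' bv' h2]]]] /=.
    + exact: Gi h1 h2.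
    + have [_ _ bc] := Gd _ _ _ h1.
      by case: h2 => /= -[_ _ ec]; subst; case: (hB _ _ bc); do ?apply/gB.
    + have [_ _ bc] := Gd _ _ _ h2.
      by case: h1 => /= -[_ _ ec]; subst; case: (hB _ _ bc); do ?apply/gB.
    + by case: h1 h2 => /= -[-> -> ->] [] /= [-> -> /hgi []] // _ -> ->.
  - move=> a b c [/Gd [? ? ?]|[u [v [bu bv]]]]; first by split; exact: Bd'1.
    by move=> [[/= -> -> ->]|[/= -> -> ->]|[/= -> -> ->]]; split;
      do ?[exact: Bd'1|apply/Bd'2 => //|apply/gB => //].
  - move=> a b /Bd' [ba|[u [bu ->]]] /Bd' [bb|[v [bv ->]]].
    + by have [c ?] := Gt _ _ ba bb; exists c; left.
    + by exists (h (g (e 1, g (a, v)))); right; exists a, v; split=> //; apply: Or32.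
    + by exists (h (g (e 0, g (u, b)))); right; exists u, b; split=> //; apply: Or31.
    + by exists (h (g (e 2, g (u, v)))); right; exists u, v; split=> //; apply: Or33.
have [z /(mG G' _ okG') Gz] := Bd'2 _ (Be 0).
by case: (hN _ (Be 0)); exists z; apply: Gz; left.
Qed.

Lemma infinite_le (L M : Type) : infinite L -> card_le (full L) (full M) -> infinite M.
Proof.
move=> [e ei] [f [_ fi]]; exists (fun n => f (e n)) => n m eq.
by apply/ei/fi.
Qed.

Lemma infinite_inh (L : Type) : infinite L -> inhabited L.
Proof. by move=> [e _]; exact: inhabits (e 0). Qed.

Lemma pairing (L : Type) : infinite L ->
  exists p : L -> L -> L, forall a b a' b', p a b = p a' b' -> a = a' /\ b = b'.
Proof.
move=> /square_le [f [_ fi]]; exists (fun a b => f (a, b)) => a b a' b' h.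
by have [-> ->] := fi _ _ I I h.
Qed.

Lemma sumP_le {U V} (A : U -> Prop) (B : V -> Prop) (L : Type) : infinite L ->
  card_le A (full L) -> card_le B (full L) -> card_le (sumP A B) (full L).
Proof.
move=> iL [f [_ fi]] [g [_ gi]]; have [p pi] := pairing iL; have [e ei] := iL.
exists (fun z => match z with inl x => p (e 0) (f x) | inr y => p (e 1) (g y) end).
split=> // -[x|x] [y|y] /= hx hy /pi [/ei h1 h2] //.
  by rewrite (fi _ _ hx hy h2).
by rewrite (gi _ _ hx hy h2).
Qed.

Lemma union_le {I U} (S : I -> Prop) (A : I -> U -> Prop) (L : Type) : infinite L ->
  card_le S (full L) -> (forall i, S i -> card_le (A i) (full L)) ->
  card_le (fun x => exists i, S i /\ A i x) (full L).
Proof.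
move=> iL [s [_ si]] hA; have [p pi] := pairing iL; have [l] := infinite_inh iL.
have [g hg] : exists g : I -> U -> L, forall i, S i ->
    forall x y, A i x -> A i y -> g i x = g i y -> x = y.
  apply: (@choice_on _ _ S (fun i (g : U -> L) => forall x y, A i x -> A i y -> g x = g y -> x = y)
            (fun _ => l)) => i /hA [g [_ gi]]; by exists g.
have [[i0]|nI] := classic (inhabited I); last first.
  exists (fun _ => l); split=> // x y [i _]; by case: nI.
have [k hk] : exists k : U -> I, forall x, (exists i, S i /\ A i x) -> S (k x) /\ A (k x) x.
  exact: (@choice_on _ _ (fun x => exists i, S i /\ A i x) (fun x i => S i /\ A i x) i0).
exists (fun x => p (s (k x)) (g (k x) x)); split=> // x y /hk [sx ax] /hk [sy ay].
move=> /pi [/si e h]; have {}e := e sx sy; rewrite -e in ay h.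
exact: hg h.
Qed.

Lemma cup_le {U} (A B : U -> Prop) (L : Type) : infinite L ->
  card_le A (full L) -> card_le B (full L) -> card_le (fun x => A x \/ B x) (full L).
Proof.
move=> iL hA hB; have [e ei] := iL.
apply: card_le_trans (@union_le bool U (full bool) (fun b => if b then A else B) L iL _ _).
- by apply: card_le_sub => x [|]; [exists true|exists false].
- by exists (fun b => if b then e 0 else e 1); split=> // -[] [] //= _ _ /ei.
- by case.
Qed.

Lemma image_le {U V} (f : U -> V) (A : U -> Prop) (u : U) :
  card_le (fun y => exists x, A x /\ f x = y) A.
Proof.
have [g hg] := @choice_on _ _ (fun y => exists x, A x /\ f x = y)
  (fun y x => A x /\ f x = y) u (fun _ => id).
exists g; split; first by move=> y /hg [].
by move=> y y' /hg [_ h] /hg [_ h'] e; rewrite -h -h' e.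
Qed.

Lemma single_le {U} (a : U) (L : Type) : inhabited L -> card_le (fun x => x = a) (full L).
Proof. by move=> [l]; exists (fun _ => l); split=> // x y -> ->. Qed.

Lemma enum_of_le {U} (A : U -> Prop) (L : Type) a : A a -> card_le A (full L) ->
  exists e : L -> U, (forall l, A (e l)) /\ forall x, A x -> exists l, e l = x.
Proof.
move=> Aa [f [_ fi]].
have h l : exists x, A x /\ ((exists x, A x /\ f x = l) -> f x = l).
  by have [[x [? ?]]|n] := classic (exists x, A x /\ f x = l); [exists x|exists a].
have [e he] := choice _ h; exists e; split=> [l|x Ax]; first by case: (he l).
exists (f x); apply: (fi); [by case: (he (f x))|by []|].
by case: (he (f x)) => _; apply; exists x.
Qed.

(** If the complement had size at most |L|, so would the whole power set, against Cantor's theorem;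
    comparability does the rest. This is the supply of fresh names in [transport]. *)
Lemma cantor_compl (L : Type) (N : (L -> Prop) -> Prop) : infinite L ->
  card_le N (full L) -> card_le (full L) (fun x => ~ N x).
Proof.
move=> iL hN; have [l] := infinite_inh iL.
apply: (@card_le_not _ _ (fun x => ~ N x) (full L) (fun _ => True) l) => hc.
have [f [_ fi]] : card_le (full (L -> Prop)) (full L).
  apply: card_le_trans (cup_le iL hN hc).
  by apply: card_le_sub => x _; exact: classic.
pose D l := forall X, f X = l -> ~ X l.
have nD : ~ D (f D) by move=> h; exact: (h D).
by apply: (nD) => X /fi -> //; exact: nD.
Qed.

(** * Well-orders and transfinite chains *)

Definition wo {I : Type} (lt : I -> I -> Prop) : Prop :=
  [/\ well_founded lt, forall i j k, lt i j -> lt j k -> lt i k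
    & forall i j, lt i j \/ i = j \/ lt j i].

Lemma wf_min {I : Type} (lt : I -> I -> Prop) (P : I -> Prop) : well_founded lt ->
  (exists i, P i) -> exists i, P i /\ forall j, lt j i -> ~ P j.
Proof.
move=> wf [i Pi]; apply: NNPP => nP; move: Pi.
elim/(well_founded_ind wf): i => i IH Pi.
by apply: nP; exists i; split=> // j /IH.
Qed.

Definition sublt {I : Type} (lt : I -> I -> Prop) (S : I -> Prop) (x y : sig S) :=
  lt (proj1_sig x) (proj1_sig y).

Lemma wo_sub {I : Type} (lt : I -> I -> Prop) (S : I -> Prop) :
  wo lt -> wo (sublt lt (S := S)).
Proof.
move=> [wf tr tot]; split.
- move=> [i Si]; elim/(well_founded_ind wf): i Si => i IH Si.
  by constructor=> -[j Sj] /= h; exact: IH.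
- by move=> [? ?] [? ?] [? ?]; exact: tr.
- move=> x y; have [h|[h|h]] := tot (proj1_sig x) (proj1_sig y); [by left| |by right; right].
  by right; left; exact: sig_inj.
Qed.

Lemma wo_exists (T : Type) : exists lt : T -> T -> Prop, wo lt.
Proof.
have [R hR] : exists R : T -> T -> bool, forall P : T -> Prop, (exists x, P x) ->
    exists z, (P z /\ forall x, P x -> R z x) /\
      forall z', (P z' /\ forall x, P x -> R z' x) -> z = z'.
  have [R hR] := wochoice.well_ordering_principle (boolp.classicType T).
  exists R => P [x Px].
  have inP (y : boolp.classicType T) : (y \in (fun y => boolp.asbool (P y))) <-> P y.
    by split=> /boolp.asboolP.
  have [|z [[/inP Pz mz] uz]] := hR (fun y => boolp.asbool (P y)).
    by exists x; apply/inP.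
  exists z; split; first by split=> // y Py; apply: mz; apply/inP.
  move=> z' [Pz' mz']; apply: uz; split; first by apply/inP.
  by move=> y /inP; exact: mz'.
(* The order axioms are recovered from unique least elements of sets of one, two and three
   points. *)
have refl x : R x x.
  by have [z [[-> h] _]] := hR (fun y => y = x) (ex_intro _ x erefl); exact: h.
have anti x y : R x y -> R y x -> x = y.
  move=> xy yx; have [|z [_ uz]] := hR (fun z => z = x \/ z = y); first by exists x; left.
  rewrite -(uz x) ?(uz y) //; split; [by right| |by left|]; by move=> w [->|->].
have tot x y : R x y \/ R y x.
  have [|z [[[->|->] mz] _]] := hR (fun z => z = x \/ z = y); first by exists x; left.
    by left; apply: mz; right.
  by right; apply: mz; left.
have trans x y z : R x y -> R y z -> R x z.
  move=> xy yz; have [|w [[[->|[->|->]] mw] _]] := hR (fun w => w = x \/ w = y \/ w = z).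
  - by exists x; left.
  - by apply: mw; right; right.
  - by rewrite (anti x y) //; apply: mw; left.
  - by rewrite -(anti y z) //; apply: mw; right; left.
exists (fun x y => R x y /\ x <> y); split.
- move=> x; apply: NNPP => nx.
  have [|z [[nz mz] _]] := hR (fun x => ~ Acc (fun x y => R x y /\ x <> y) x).
    by exists x.
  apply: nz; constructor=> y [yz ne]; apply: NNPP => ny.
  by apply: ne; apply: anti => //; exact: mz.
- move=> x y z [xy nxy] [yz nyz]; split; first exact: trans yz.
  by move=> e; apply: nxy; apply: anti => //; rewrite e.
- move=> x y; have [->|ne] := classic (x = y); first by right; left.
  by case: (tot x y) => h; [left|right; right]; split=> // e; apply: ne.
Qed.

(** Cutting a well-order at the least point whose segment is as large as [T] gives the initial
    ordinal of |T|. In a construction of that length every stage has fewer than |T| predecessors. *)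
Lemma wo_initial (T : Type) : inhabited T -> exists (I : Type) (lt : I -> I -> Prop),
  [/\ wo lt, card_le (full I) (full T), card_le (full T) (full I)
    & forall i, ~ card_le (full T) (fun j => lt j i)].
Proof.
move=> [t0]; have [lt wlt] := wo_exists T; have [wf tr tot] := wlt.
have [h|nh] := classic (exists i, card_le (full T) (fun j => lt j i)); last first.
  exists T, lt; split=> //; try exact: card_le_refl.
  by move=> i h; apply: nh; exists i.
have [i [hi mi]] := wf_min wf h.
exists (sig (fun j => lt j i)), (sublt lt (S := _)); split.
- exact: wo_sub.
- exact: card_le_full (card_sig_le _).
- have [g [gi _]] := hi.
  by apply: card_le_trans hi _; apply: (@card_le_sig _ _ (g t0)); exact: gi.
- move=> [j ji] hj; apply: (mi j ji); apply: card_le_trans hj _.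
  by exists (@proj1_sig _ _); split=> // x y _ _; exact: sig_inj.
Qed.

(** Cutting at the first segment larger than [N], if there is one, makes [W] the successor cardinal
    of |N|; it fits in [T] because |T| > |N|. *)
Lemma wo_succ (N T : Type) : inhabited N -> ~ card_le (full T) (full N) ->
  exists (W : Type) (lt : W -> W -> Prop),
  [/\ wo lt, card_le (full W) (full T), ~ card_le (full W) (full N)
    & forall i, card_le (fun j => lt j i) (full N)].
Proof.
move=> [n0] nTN; have [lt wlt] := wo_exists T; have [wf tr tot] := wlt.
have [h|nh] := classic (exists i, ~ card_le (fun j => lt j i) (full N)); last first.
  exists T, lt; split=> //; first exact: card_le_refl.
  by move=> i; apply: NNPP => h; apply: nh; exists i.
have [i [hi mi]] := wf_min wf h.
exists (sig (fun j => lt j i)), (sublt lt (S := _)); split.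
- exact: wo_sub.
- exact: card_le_full (card_sig_le _).
- by move=> hc; apply: hi; exact: card_le_of_sig.
- move=> [j ji]; apply: card_le_trans (NNPP _ (mi j ji)).
  by exists (@proj1_sig _ _); split=> // x y _ _; exact: sig_inj.
Qed.

(** The recursion picks values by [epsilon] without any proof at hand. That they satisfy [P] is
    shown afterwards by induction: [P i] reads [f] only below [i], so the default [t0] elsewhere is
    harmless. *)
Lemma wf_choice (I : Type) (lt : I -> I -> Prop) (T : Type) (P : I -> (I -> T) -> T -> Prop) :
  well_founded lt -> (forall i j k, lt i j -> lt j k -> lt i k) -> inhabited T ->
  (forall i f f' t, (forall j, lt j i -> f j = f' j) -> P i f t -> P i f' t) ->
  (forall i f, (forall j, lt j i -> P j f (f j)) -> exists t, P i f t) ->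
  exists f, forall i, P i f (f i).
Proof.
move=> wf tr [t0] hP hex.
pose step i (rec : forall j, lt j i -> T) : T :=
  epsilon (inhabits t0) (P i (fun j =>
    match excluded_middle_informative (lt j i) with left h => rec j h | right _ => t0 end)).
pose f := Fix wf (fun _ => T) step.
have fE i : f i = epsilon (inhabits t0) (P i (fun j =>
    match excluded_middle_informative (lt j i) with left _ => f j | right _ => t0 end)).
  rewrite /f Fix_eq // => j g g' e; rewrite /step; congr (epsilon _ (P _ _)).
  apply: functional_extensionality => k.
  by case: excluded_middle_informative.
exists f => i; elim/(well_founded_ind wf): i => i IH.
have eqf j : lt j i -> (match excluded_middle_informative (lt j i) with left _ => f j | right _ => t0 end) = f j.
  by case: excluded_middle_informative.
apply: (hP _ _ _ _ eqf); rewrite fE; apply: epsilon_spec.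
have [t Pt] := hex i f IH; exists t; apply: hP Pt => j /eqf ->; by [].
Qed.

(* Transfinite construction of a chain: each stage first bounds the previous
   stages by some [s], then moves on by one step [Q i s (f i)]. *)
Lemma wo_chain (I : Type) (lt : I -> I -> Prop) (T : Type) (ok : I -> T -> Prop)
    (le : T -> T -> Prop) (Q : I -> T -> T -> Prop) :
  wo lt -> inhabited T ->
  (forall x y z, le x y -> le y z -> le x z) ->
  (forall i f, (forall j, lt j i -> ok j (f j)) ->
     (forall j k, lt j k -> lt k i -> le (f j) (f k)) ->
     exists s, ok i s /\ forall j, lt j i -> le (f j) s) ->
  (forall i s, ok i s -> exists s', [/\ ok i s', le s s' & Q i s s']) ->
  exists f, [/\ forall i, ok i (f i), forall i j, lt i j -> le (f i) (f j)
    & forall i, exists s, [/\ ok i s, forall j, lt j i -> le (f j) s, le s (f i) & Q i s (f i)]].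
Proof.
move=> [wf tr tot] iT trans ub step.
pose P i (f : I -> T) t := ok i t /\
  exists s, [/\ ok i s, forall j, lt j i -> le (f j) s, le s t & Q i s t].
have [||f hf] := @wf_choice I lt T P wf tr iT.
- move=> i f f' t e [okt [s [oks us st q]]]; split=> //; exists s; split=> // j ji.
  by rewrite -e //; exact: us.
- move=> i f hf.
  have [||s [oks us]] := ub i f.
  + by move=> j /hf [].
  + move=> j k jk /hf [_ [s [_ us sk _]]]; exact: trans (us _ jk) sk.
  have [s' [oks' ss' q]] := step i s oks.
  by exists s'; split=> //; exists s.
exists f; split.
- by move=> i; case: (hf i).
- move=> i j ij; have [_ [s [_ us sj _]]] := hf j; exact: trans (us _ ij) sj.
- by move=> i; case: (hf i).
Qed.

(** * Isomorphisms and unions of chains *)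

Section Structures.
Variable tau : vocab.

Lemma sub_sub {U} (M0 M1 N : structure tau U) :
  substructure M0 N -> substructure M1 N -> (forall x, sdom M0 x -> sdom M1 x) ->
  substructure M0 M1.
Proof.
move=> [d [f r]] [d' [f' r']] s; split=> //; split=> t xs h.
  by rewrite f // f' // => i; exact: s.
by rewrite r // r' // => i; exact: s.
Qed.

Lemma iso_refl {U} (M : structure tau U) : iso (fun x => x) M M.
Proof. by split; [|split; [|split; [|split]]] => // x Mx; exists x. Qed.

Lemma iso_comp {U V W} (f : U -> V) (g : V -> W) (M : structure tau U)
    (N : structure tau V) (P : structure tau W) :
  iso f M N -> iso g N P -> iso (fun x => g (f x)) M P.
Proof.
move=> [d [i [s [h r]]]] [d' [i' [s' [h' r']]]]; split; [|split; [|split; [|split]]].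
- by move=> x /d /d'.
- move=> x y Mx My /i' e; apply: i => //; apply: e; exact: d.
- by move=> z /s' [y [/s [x [Mx <-]] <-]]; exists x.
- by move=> t xs hx; rewrite h // h' // => j; exact: d.
- by move=> t xs hx; rewrite r // r' // => j; exact: d.
Qed.

Lemma iso_inv {U V} (u : U) (f : U -> V) (M : structure tau U) (N : structure tau V) :
  iso f M N -> exists g, [/\ iso g N M, forall x, sdom M x -> g (f x) = x
                        & forall y, sdom N y -> f (g y) = y].
Proof.
move=> [d [i [s [h r]]]].
have [g hg] := @choice_on _ _ (sdom N) (fun y x => sdom M x /\ f x = y) u s.
have gd y : sdom N y -> sdom M (g y) by case/hg.
have fg y : sdom N y -> f (g y) = y by case/hg.
have gf x : sdom M x -> g (f x) = x.
  by move=> Mx; apply: i => //; [apply/gd/d|apply/fg/d].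
have fgx n (ys : arg n -> V) : (forall j, sdom N (ys j)) -> (fun j => f (g (ys j))) = ys.
  by move=> hy; apply: functional_extensionality => j; exact: fg.
exists g; split=> //; split=> //; split; [|split; [|split]].
- by move=> x y Nx Ny e; rewrite -(fg x) // -(fg y) // e.
- by move=> x Mx; exists (f x); split; [exact: d|exact: gf].
- move=> t ys hy; rewrite -{1}(fgx _ ys hy) -h => [|j]; last exact: gd.
  by rewrite gf //; apply: sclosed => j; exact: gd.
- move=> t ys hy; rewrite -{1}(fgx _ ys hy) r // => j; exact: gd.
Qed.

Lemma iso_ext {U V} (f g : U -> V) (M : structure tau U) (N : structure tau V) :
  (forall x, sdom M x -> f x = g x) -> iso f M N -> iso g M N.
Proof.
move=> e [d [i [s [h r]]]].
have ex n (xs : arg n -> U) : (forall j, sdom M (xs j)) ->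
    (fun j => f (xs j)) = (fun j => g (xs j)).
  by move=> hx; apply: functional_extensionality => j; exact: e.
split; [|split; [|split; [|split]]].
- by move=> x Mx; rewrite -e //; exact: d.
- by move=> x y Mx My; rewrite -!e //; exact: i.
- by move=> y /s [x [Mx <-]]; exists x; rewrite e.
- by move=> t xs hx; rewrite -e ?h ?ex //; exact: sclosed.
- by move=> t xs hx; rewrite r ?ex.
Qed.

Lemma iso_image {U V} (u : U) (f : U -> V) (M : structure tau U) :
  (forall x y, sdom M x -> sdom M y -> f x = f y -> x = y) ->
  exists N : structure tau V, iso f M N.
Proof.
move=> i.
have [g hg] := @choice_on _ _ (fun y => exists x, sdom M x /\ f x = y)
  (fun y x => sdom M x /\ f x = y) u (fun _ h => h).
have gf x : sdom M x -> g (f x) = x.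
  by move=> Mx; have [|? ?] := hg (f x); [exists x|exact: i].
have gfx n (xs : arg n -> U) : (forall j, sdom M (xs j)) -> (fun j => g (f (xs j))) = xs.
  by move=> hx; apply: functional_extensionality => j; exact: gf.
unshelve eexists {| sdom y := exists x, sdom M x /\ f x = y;
  sfun s ys := f (sfun M s (fun j => g (ys j)));
  srel r ys := srel M r (fun j => g (ys j)) |}.
  move=> s ys hy /=; exists (sfun M s (fun j => g (ys j))); split=> //.
  by apply: sclosed => j; case: (hg _ (hy j)).
split; [|split; [|split; [|split]]] => //=.
- by move=> x Mx; exists x.
- by move=> s xs hx; rewrite gfx.
- by move=> s xs hx; rewrite gfx.
Qed.

(** Structures may differ by junk outside their domain, so the image of a structure is unique only
    up to an isomorphism along the identity. *)
Lemma iso_uniq {U V} (f : U -> V) (M : structure tau U) (N N' : structure tau V) :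
  iso f M N -> iso f M N' -> iso (fun x => x) N N'.
Proof.
move=> [d [i [s [h r]]]] [d' [i' [s' [h' r']]]].
have ch n (ys : arg n -> V) : (forall j, sdom N (ys j)) ->
    exists xs, (forall j, sdom M (xs j)) /\ ys = (fun j => f (xs j)).
  move=> hy; have [xs hx] := choice _ (fun j => s _ (hy j)).
  exists xs; split=> [j|]; first by case: (hx j).
  by apply: functional_extensionality => j; case: (hx j).
split; [|split; [|split; [|split]]] => //.
- by move=> y /s [x [/d' Mx <-]].
- by move=> y /s' [x [/d Mx <-]]; exists (f x).
- by move=> t ys /ch [xs [hx ->]]; rewrite -h // -h'.
- by move=> t ys /ch [xs [hx ->]]; rewrite -r // -r'.
Qed.

Lemma sub_full {U} (M N : structure tau U) :
  substructure M N -> (forall x, sdom N x -> sdom M x) -> iso (fun x => x) M N.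
Proof.
move=> [d [f r]] e; split; [|split; [|split; [|split]]] => //.
by move=> x Nx; exists x; split=> //; exact: e.
Qed.

Lemma iso_id_sym {U} (M N : structure tau U) :
  iso (fun x => x) M N -> iso (fun x => x) N M.
Proof. move=> h; exact: iso_uniq h (iso_refl M). Qed.

Lemma iso_sub {U V} (f : U -> V) (M0 M : structure tau U) (N0 N : structure tau V) :
  iso f M N -> iso f M0 N0 -> substructure M0 M -> substructure N0 N.
Proof.
move=> [d [i [s [h r]]]] [d' [i' [s' [h' r']]]] [D [F R]].
have ch n (ys : arg n -> V) : (forall j, sdom N0 (ys j)) ->
    exists xs, (forall j, sdom M0 (xs j)) /\ ys = (fun j => f (xs j)).
  move=> hy; have [xs hx] := choice _ (fun j => s' _ (hy j)).
  exists xs; split=> [j|]; first by case: (hx j).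
  by apply: functional_extensionality => j; case: (hx j).
split; first by move=> y /s' [x [/D /d ? <-]].
split=> t ys /ch [xs [hx ->]].
  by rewrite -h' // F // h // => j; exact: D.
by rewrite -r' // R // r // => j; exact: D.
Qed.

Lemma iso_card {U V} (f : U -> V) (M : structure tau U) (N : structure tau V) :
  iso f M N -> card_le (sdom M) (sdom N).
Proof. by move=> [d [i _]]; exists f; split. Qed.

(** Symbols are finitary, so a tuple from the union of a chain lies in a single stage. This is what
    lets [union_exists] interpret the symbols on the union. *)
Lemma finite_bound {I} (lt : I -> I -> Prop) n (P : arg n -> I -> Prop) : wo lt ->
  inhabited I -> (forall a i j, P a i -> lt i j -> P a j) -> (forall a, exists i, P a i) ->
  exists k, forall a, P a k.
Proof.
move=> [wf tr tot] [i0]; elim: n P => [|n IH] P mono ex.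
  by exists i0 => -[a h]; case: (PeanoNat.Nat.nlt_0_r _ h).
have lS a : a < n -> a < S n by move=> h; apply: PeanoNat.Nat.lt_lt_succ_r.
pose inc (a : arg n) : arg (S n) := exist _ (proj1_sig a) (lS _ (proj2_sig a)).
have [||k hk] := IH (fun a => P (inc a)); [by move=> a; exact: mono|by []|].
pose l : arg (S n) := exist _ n (PeanoNat.Nat.lt_succ_diag_r n).
have [k' hk'] := ex l.
have hP m : P l m -> (forall a, P (inc a) m) -> forall a, P a m.
  move=> hl ha a.
  have [e|ne] := classic (proj1_sig a = n).
    by have -> : a = l by apply: sig_inj; rewrite e.
  have h : proj1_sig a < n.
    by case: a ne => a ha' /= ne; case/PeanoNat.Nat.lt_eq_cases: (proj1 (PeanoNat.Nat.lt_succ_r _ _) ha').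
  have -> : a = inc (exist _ (proj1_sig a) h) by apply: sig_inj.
  exact: ha.
case: (tot k k') => [lk|[e|lk]].
- by exists k'; apply: hP => // a; exact: mono lk.
- by subst; exists k'; exact: hP.
- by exists k; apply: hP => //; exact: mono lk.
Qed.

Lemma union_exists {I U} (lt : I -> I -> Prop) (M : I -> structure tau U) :
  wo lt -> inhabited I -> (forall i j, lt i j -> substructure (M i) (M j)) ->
  exists Md, is_union M Md.
Proof.
move=> wlt [i0] inc; have [wf tr tot] := wlt.
have bd n (xs : arg n -> U) : (forall a, exists i, sdom (M i) (xs a)) ->
    exists k, forall a, sdom (M k) (xs a).
  apply: (finite_bound wlt (inhabits i0)) => a i j h /inc [d _]; exact: d.
have [k hk] : exists k : forall n, (arg n -> U) -> I, forall n xs,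
    (forall a, exists i, sdom (M i) (xs a)) -> forall a, sdom (M (k n xs)) (xs a).
  have h n : exists k : (arg n -> U) -> I, forall xs,
      (forall a, exists i, sdom (M i) (xs a)) -> forall a, sdom (M (k xs)) (xs a).
    apply: (@choice_on _ _ (fun xs : arg n -> U => forall a, exists i, sdom (M i) (xs a))
             (fun xs k => forall a, sdom (M k) (xs a)) i0); exact: bd.
  exists (fun n => proj1_sig (constructive_indefinite_description _ (h n))) => n xs.
  by case: constructive_indefinite_description => k /= hk; exact: hk.
unshelve eexists {| sdom x := exists i, sdom (M i) x;
  sfun s xs := sfun (M (k _ xs)) s xs; srel r xs := srel (M (k _ xs)) r xs |}.
  by move=> s xs hx; exists (k _ xs); apply: sclosed; exact: hk.
split=> // i; split; first by move=> x; exists i.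
have cmp n (xs : arg n -> U) : (forall a, sdom (M i) (xs a)) ->
    (forall a, sdom (M (k _ xs)) (xs a)) by move=> h; apply: hk => a; exists i.
split=> s xs hx /=.
  case: (tot i (k _ xs)) => [/inc [_ [h _]]|[<-|/inc [_ [h _]]]] //; first exact: h.
  by rewrite h //; exact: cmp.
case: (tot i (k _ xs)) => [/inc [_ [_ h]]|[<-|/inc [_ [_ h]]]] //; first exact: h.
by rewrite h //; exact: cmp.
Qed.

Lemma glue {I U V} (v : V) (lt : I -> I -> Prop) (A : I -> U -> Prop) (g : I -> U -> V) :
  wo lt -> (forall i j, lt i j -> forall x, A i x -> g j x = g i x) ->
  exists G, forall i x, A i x -> G x = g i x.
Proof.
move=> [wf tr tot] e.
have h x : (exists i, A i x) -> exists y, forall i, A i x -> y = g i x.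
  move=> hx; have [i [Aix mi]] := wf_min wf hx; exists (g i x) => j Ajx.
  case: (tot i j) => [lij|[->|lji]] //; first by rewrite (e i j).
  by case: (mi j lji).
have [G hG] := @choice_on _ _ (fun x => exists i, A i x)
  (fun x y => forall i, A i x -> y = g i x) v h.
by exists G => i x Aix; apply: hG => //; exists i.
Qed.

End Structures.

(** * K-embeddings *)

Section Kemb.
Variable tau : vocab.
Variable K : aclass tau.
Hypothesis HK : fragmented_AEC K.

Lemma le_in1 {U} (M N : structure tau U) : leK K M N -> inK K M.
Proof. by case: HK => -[_ [h _]] _ /h []. Qed.

Lemma le_in2 {U} (M N : structure tau U) : leK K M N -> inK K N.
Proof. by case: HK => -[_ [h _]] _ /h [_ []]. Qed.

Lemma le_sub {U} (M N : structure tau U) : leK K M N -> substructure M N.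
Proof. by case: HK => -[_ [h _]] _ /h [_ []]. Qed.

Lemma le_dom {U} (M N : structure tau U) x : leK K M N -> sdom M x -> sdom N x.
Proof. by move=> /le_sub [h _] /h. Qed.

Lemma le_refl {U} (M : structure tau U) : inK K M -> leK K M M.
Proof. by case: HK => -[_ [_ [h _]]] _; exact: h. Qed.

Lemma le_trans {U} (M N P : structure tau U) : leK K M N -> leK K N P -> leK K M P.
Proof. case: HK => -[_ [_ [_ [h _]]]] _; exact: h. Qed.

Lemma le_iso {U V} (f : U -> V) (M N : structure tau U) (M' N' : structure tau V) :
  leK K M N -> iso f N N' -> iso f M M' -> leK K M' N'.
Proof. by case: HK => -[_ [_ [_ [_ h]]]] _; exact: h. Qed.

Lemma in_iso {U V} (f : U -> V) (M : structure tau U) (M' : structure tau V) :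
  inK K M -> iso f M M' -> inK K M'.
Proof. by case: HK => -[h _] _; exact: h. Qed.

(** Both models are substructures of [M2], so inclusion of the domains already gives the
    substructure relation that coherence asks for. *)
Lemma le_coh {U} (M0 M1 M2 : structure tau U) :
  leK K M0 M2 -> leK K M1 M2 -> (forall x, sdom M0 x -> sdom M1 x) -> leK K M0 M1.
Proof.
move=> h0 h1 s; have [_ [_ [h _]]] := HK; apply: (h _ _ _ M2) => //.
- exact: le_in1 h0.
- exact: le_in1 h1.
- exact: le_in2 h1.
- exact: sub_sub (le_sub h0) (le_sub h1) s.
Qed.

Lemma le_card {U} (M N : structure tau U) : leK K M N -> card_le (sdom M) (sdom N).
Proof. by move=> h; apply: card_le_sub => x; exact: le_dom. Qed.

Lemma kemb_iso {U V} (f : U -> V) (M : structure tau U) (N : structure tau V) :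
  inK K N -> iso f M N -> kemb K f M N.
Proof. by move=> KN h; exists N; split=> //; exact: le_refl. Qed.

Lemma kemb_le {U} (M N : structure tau U) : leK K M N -> kemb K (fun x => x) M N.
Proof. by move=> h; exists M; split=> //; exact: iso_refl. Qed.

Lemma kemb_dom {U V} (f : U -> V) (M : structure tau U) (N : structure tau V) x :
  kemb K f M N -> sdom M x -> sdom N (f x).
Proof. by move=> [M' [[d _] l]] /d; exact: le_dom. Qed.

Lemma kemb_inj {U V} (f : U -> V) (M : structure tau U) (N : structure tau V) x y :
  kemb K f M N -> sdom M x -> sdom M y -> f x = f y -> x = y.
Proof. by move=> [M' [[_ [i _]] l]]; exact: i. Qed.

Lemma kemb_in {U V} (f : U -> V) (M : structure tau U) (N : structure tau V) :
  kemb K f M N -> inK K N.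
Proof. by move=> [M' [_ l]]; exact: le_in2 l. Qed.

Lemma kemb_card {U V} (f : U -> V) (M : structure tau U) (N : structure tau V) :
  kemb K f M N -> card_le (sdom M) (sdom N).
Proof.
move=> h; exists f; split=> [x|x y]; [exact: kemb_dom|exact: kemb_inj h].
Qed.

Lemma kemb_ext {U V} (f g : U -> V) (M : structure tau U) (N : structure tau V) :
  (forall x, sdom M x -> f x = g x) -> kemb K f M N -> kemb K g M N.
Proof. by move=> e [M' [h l]]; exists M'; split=> //; exact: iso_ext h. Qed.

Lemma kemb_comp {U V W} (f : U -> V) (g : V -> W) (M : structure tau U)
    (N : structure tau V) (P : structure tau W) :
  kemb K f M N -> kemb K g N P -> kemb K (fun x => g (f x)) M P.
Proof.
move=> [M' [hf l]] [N' [hg l']].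
(* [iso_image] needs a default point of [V]. If [V] is empty, so are [M'] and [N], and the identity
   is an isomorphism between them. *)
have [[v]|nV] := classic (inhabited V); last first.
  have e : iso (fun y => y) M' N.
    by apply: (sub_full (le_sub l)) => v _; case: nV; exact: (inhabits v).
  by exists N'; split=> //; exact: (iso_comp (iso_comp hf e) hg).
have [M'' hM] : exists M'', iso g M' M''.
  by apply: (iso_image v) => x y /(le_dom l) Nx /(le_dom l) Ny; case: hg => _ [i _]; exact: i.
exists M''; split; first exact: (iso_comp hf hM).
exact: le_trans (le_iso l hg hM) l'.
Qed.

Lemma kemb_sub {U V} (f : U -> V) (M0 M : structure tau U) (N : structure tau V) :
  kemb K f M N -> leK K M0 M -> kemb K f M0 N.
Proof. by move=> h /kemb_le h0; exact: (kemb_comp h0 h). Qed.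

Lemma kemb_up {U V} (f : U -> V) (M : structure tau U) (N N' : structure tau V) :
  kemb K f M N -> leK K N N' -> kemb K f M N'.
Proof. by move=> [M' [h l]] l'; exists M'; split=> //; exact: le_trans l'. Qed.

Lemma kemb_down {U V} (f : U -> V) (M : structure tau U) (N0 N : structure tau V) :
  kemb K f M N -> leK K N0 N -> (forall x, sdom M x -> sdom N0 (f x)) -> kemb K f M N0.
Proof.
move=> [M' [h l]] l0 s; exists M'; split=> //; apply: le_coh l l0 _ => y.
by case: h => _ [_ [sj _]] /sj [x [/s ? <-]].
Qed.

Lemma kemb_id_le {U} (M N : structure tau U) : kemb K (fun x => x) M N -> leK K M N.
Proof.
move=> [M' [h l]]; apply: (le_iso l (iso_refl N)); exact: iso_id_sym.
Qed.

Lemma kemb_le_iso {U V} (g : U -> V) (k : V -> U) (N : structure tau U) (P : structure tau V)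
    (P' : structure tau U) :
  kemb K g N P -> iso k P P' -> (forall x, sdom N x -> k (g x) = x) -> leK K N P'.
Proof.
move=> hg hk e; apply: kemb_id_le; apply: (kemb_ext e).
exact: (kemb_comp hg (kemb_iso (in_iso (kemb_in hg) hk) hk)).
Qed.

(** Smoothness speaks of limit orders only. If there is a last index, the union is the last member
    up to values outside the domain; thus constructions can run along any nonempty well-order. *)
Lemma union_smooth {I U} (lt : I -> I -> Prop) (M : I -> structure tau U) Md N :
  wo lt -> inhabited I -> (forall i j, lt i j -> leK K (M i) (M j)) ->
  is_union M Md -> (forall i, leK K (M i) N) -> leK K Md N.
Proof.
move=> [wf tr tot] iI inc un hN; have [_ [_ [_ [_ sm]]]] := HK.
have [hl|nl] := classic (forall i, exists j, lt i j).
  suff [] : inK K Md /\ leK K Md N by [].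
  apply: (sm I lt U M Md N) => //.
  by split=> // i; exact: le_in1 (hN i).
have [m hm] : exists m, forall j, ~ lt m j.
  apply: NNPP => h; apply: nl => i; apply: NNPP => h'; apply: h; exists i => j lj.
  by apply: h'; exists j.
apply: (le_iso (hN m) (iso_refl N)); apply: sub_full; first by case: un.
move=> x; case: un => + _ => -> [i]; case: (tot i m) => [l|[->|/hm]] //.
exact: le_dom (inc _ _ l).
Qed.

Lemma union_chain {I U} (lt : I -> I -> Prop) (M : I -> structure tau U) Md :
  wo lt -> inhabited I -> (forall i, inK K (M i)) ->
  (forall i j, lt i j -> leK K (M i) (M j)) ->
  is_union M Md -> (exists i, card_le (sdom Md) (sdom (M i))) -> forall i, leK K (M i) Md.
Proof.
move=> [wf tr tot] iI inM inc un [c hc] i; have [_ [_ [_ [rc _]]]] := HK.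
have hU j : substructure (M j) Md by case: un.
have [hl|nl] := classic (forall i, exists j, lt i j); last first.
  have [m hm] : exists m, forall j, ~ lt m j.
    apply: NNPP => h; apply: nl => k; apply: NNPP => h'; apply: h; exists k => j lj.
    by apply: h'; exists j.
  have e : iso (fun x => x) (M m) Md.
    apply: sub_full => // x; case: un => + _ => -> [j].
    by case: (tot j m) => [l|[->|/hm]] //; exact: le_dom (inc _ _ l).
  have l : leK K (M i) (M m).
    by case: (tot i m) => [/inc|[->|/hm]] //; exact: le_refl.
  exact: (le_iso l e (iso_refl _)).
(* Freeze the chain below i, so that the axiom applies at its least index. *)
pose M' j := if excluded_middle_informative (lt i j) then M j else M i.
have M'i j : leK K (M i) (M' j).
  by rewrite /M'; case: excluded_middle_informative => /=; [exact: inc|move=> _; exact: le_refl].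
have M'M j : leK K (M j) (M' j).
  rewrite /M'; case: excluded_middle_informative => /= h; first exact: le_refl.
  by case: (tot i j) => [/h|[->|/inc]] //; exact: le_refl.
have inM' j : inK K (M' j) by exact: le_in2 (M'i j).
have M'U j : exists k, M' j = M k.
  by rewrite /M'; case: excluded_middle_informative => /= _; [exists j|exists i].
have [m [_ mm]] : exists m, True /\ forall j, lt j m -> ~ True.
  by apply: wf_min => //; exists i.
have hm j : ~ lt j m by move=> /mm; apply.
have [] : inK K Md /\ forall i0, (forall j, ~ lt j i0) -> leK K (M' i0) Md; last first.
  by move=> _ h; exact: (le_trans (M'i m) (h m hm)).
apply: (rc I lt U M' Md).
- by split=> //; split.
- split=> // j k jk; rewrite {2}/M'; case: excluded_middle_informative => /= h.
    rewrite /M'; case: excluded_middle_informative => /= _; exact: inc.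
  rewrite /M'; case: excluded_middle_informative => /= h'; last exact: le_refl.
  by case: h; exact: tr jk.
- split=> [x|j]; last by have [k ->] := M'U j.
  case: un => -> _; split=> -[j hj]; first by exists j; exact: le_dom hj.
  by have [k e] := M'U j; exists k; rewrite -e.
- exists c; split.
    by have [k ->] := M'U c; apply: card_le_sub => x; case: (hU k) => h _; exact: h.
  exact: card_le_trans hc (le_card (M'M c)).
Qed.

(** The images of the stages are strong in [N], so smoothness inside [N] handles their union,
    whatever the sizes of the stages. *)
Lemma kemb_union {I U V} (u : U) (lt : I -> I -> Prop) (A : I -> structure tau U) Ad
    (g : U -> V) (N : structure tau V) :
  wo lt -> inhabited I -> (forall i j, lt i j -> leK K (A i) (A j)) ->
  is_union A Ad -> (forall i, kemb K g (A i) N) -> kemb K g Ad N.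
Proof.
move=> wlt iI inc un hg; have [wf tr tot] := wlt; have [dU sU] := un.
have gi x y : sdom Ad x -> sdom Ad y -> g x = g y -> x = y.
  rewrite !dU => -[i hx] [j hy]; case: (tot i j) => [l|[e|l]].
  - by apply: (kemb_inj (hg j)) => //; exact: le_dom (inc _ _ l) hx.
  - by subst; exact: (kemb_inj (hg j)).
  - by apply: (kemb_inj (hg i)) => //; exact: le_dom (inc _ _ l) hy.
have [B hB] := iso_image u gi.
have [Bi hBi] := choice _ hg.
exists B; split=> //; apply: (@union_smooth I V lt Bi B N) => //.
- move=> i j l; have [h _] := hBi i; have [h' _] := hBi j; exact: le_iso (inc _ _ l) h' h.
- split=> [y|i]; last by have [h _] := hBi i; exact: iso_sub hB h (sU i).
  split.
    case: hB => _ [_ [s _]] /s [x [+ <-]]; rewrite dU => -[i hx]; exists i.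
    by case: (hBi i) => -[d _] _; exact: d.
  move=> [i]; case: (hBi i) => -[_ [_ [s _]]] _ /s [x [hx <-]].
  by case: hB => d _; apply: d; rewrite dU; exists i.
- by move=> i; case: (hBi i).
Qed.

End Kemb.

(** Limit step for partial embeddings: domains are united in [M] by smoothness of [K1], images in
    [N] by smoothness of [K2]. It is used with [K1 = K2] to derive homogeneity from saturation, and
    with two classes in the back-and-forth, where the domains must increase for both orders. *)
Lemma kemb_glue (tau : vocab) (K1 K2 : aclass tau) {I U V} (x0 : U) (lt : I -> I -> Prop)
    (A : I -> structure tau U) (g : I -> U -> V) (M : structure tau U) (N : structure tau V) :
  fragmented_AEC K1 -> fragmented_AEC K2 -> wo lt -> inhabited I ->
  (forall i, leK K1 (A i) M) -> (forall i, kemb K2 (g i) (A i) N) ->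
  (forall i j, lt i j -> leK K1 (A i) (A j)) -> (forall i j, lt i j -> leK K2 (A i) (A j)) ->
  (forall i j, lt i j -> forall x, sdom (A i) x -> g j x = g i x) ->
  exists Ad G, [/\ forall x, sdom Ad x <-> exists i, sdom (A i) x,
    leK K1 Ad M, forall i, leK K1 (A i) Ad, kemb K2 G Ad N
    & forall i x, sdom (A i) x -> G x = g i x].
Proof.
move=> HK1 HK2 wlt iI lM kN inc1 inc2 agree; have [i0] := iI.
have [|Ad un] := union_exists (M := A) wlt iI.
  by move=> i j /inc1; exact: (le_sub HK1).
have [dA _] := un.
have lAd : leK K1 Ad M by exact: (union_smooth HK1 wlt iI inc1 un).
have [G hG] := glue (g i0 x0) wlt agree.
exists Ad, G; split=> //.
  by move=> i; apply: (le_coh HK1 (lM i) lAd) => x hx; rewrite dA; exists i.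
apply: (kemb_union HK2 x0 wlt iI inc2 un) => i.
by apply: (kemb_ext (f := g i)) => // x hx; rewrite (hG i).
Qed.

(** * Amalgams of bounded size *)

Section Amalgams.
Variable tau : vocab.
Variable K : aclass tau.
Hypothesis HK : fragmented_AEC K.
Variable LS : Type.
Hypothesis HL : LS_prop K LS.

Lemma LS_infinite : infinite LS.
Proof. by case: HL. Qed.

Variable L : Type.
Hypothesis LSL : card_le (full LS) (full L).

Lemma above_LS_infinite : infinite L.
Proof. exact: infinite_le LS_infinite LSL. Qed.
Let iL := above_LS_infinite.

Lemma LS_below {U} (M : structure tau U) (A : U -> Prop) : inK K M ->
  (forall x, A x -> sdom M x) -> card_le A (full L) ->
  exists M0, [/\ leK K M0 M, forall x, A x -> sdom M0 x & card_le (sdom M0) (full L)].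
Proof.
move=> inM AM cA; have [_ [_ h]] := HL; have [M0 [l [s c]]] := h _ M A inM AM.
exists M0; split=> //; apply: card_le_trans c _; exact: sumP_le.
Qed.

(** The set to be covered is enlarged by a copy of [L], which forces the lower bound on the size.
    Exact sizes are what [homogeneous] accepts. *)
Lemma LS_exact {U} (M : structure tau U) (A : U -> Prop) : inK K M ->
  (forall x, A x -> sdom M x) -> card_le A (full L) -> card_le (full L) (sdom M) ->
  exists M0, [/\ leK K M0 M, forall x, A x -> sdom M0 x & card_eq (sdom M0) (full L)].
Proof.
move=> inM AM cA [e [eM ei]]; have [l0] := infinite_inh iL.
have [|||M0 [l s c]] := @LS_below U M (fun x => A x \/ exists i, full L i /\ e i = x).
- by [].
- by move=> x [/AM|[i [_ <-]]] //; exact: eM.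
- apply: (cup_le iL cA); exact: image_le.
exists M0; split=> //; first by move=> x Ax; apply: s; left.
by split=> //; exists e; split=> // i _; apply: s; right; exists i.
Qed.

Lemma shrink {U1 U2 V} (N1 : structure tau U1) (N2 : structure tau U2)
    (P : structure tau V) h1 h2 (u1 : U1) (u2 : U2) :
  kemb K h1 N1 P -> kemb K h2 N2 P ->
  card_le (sdom N1) (full L) -> card_le (sdom N2) (full L) ->
  exists P0, [/\ leK K P0 P, kemb K h1 N1 P0, kemb K h2 N2 P0 & card_le (sdom P0) (full L)].
Proof.
move=> k1 k2 c1 c2.
pose A y := (exists x, sdom N1 x /\ h1 x = y) \/ (exists x, sdom N2 x /\ h2 x = y).
have [|||P0 [l s c]] := @LS_below V P A.
- exact: kemb_in k1.
- move=> y [[x [hx <-]]|[x [hx <-]]]; [exact: kemb_dom k1 hx|exact: kemb_dom k2 hx].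
- apply: (cup_le iL); [exact: card_le_trans (image_le _ _ u1) c1|].
  exact: card_le_trans (image_le _ _ u2) c2.
exists P0; split=> //.
  by apply: (kemb_down HK k1 l) => x hx; apply: s; left; exists x.
by apply: (kemb_down HK k2 l) => x hx; apply: s; right; exists x.
Qed.

(* Renaming a K-extension of N inside the power set of L, where the complement
   of N is large enough to receive the new elements. *)
Lemma transport {V} (v : V) (N : structure tau (L -> Prop)) (P : structure tau V) h :
  kemb K h N P -> card_le (sdom P) (full L) ->
  exists (k : V -> L -> Prop) (P' : structure tau (L -> Prop)),
    [/\ iso k P P', leK K N P' & forall x, sdom N x -> k (h x) = x].
Proof.
move=> kh cP.
have [c [cN ci]] := cantor_compl iL (card_le_trans (kemb_card HK kh) cP).
have [p [_ pi]] := cP.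
have hk y : exists z, (forall x, sdom N x -> h x = y -> z = x) /\
    ((forall x, sdom N x -> h x <> y) -> z = c (p y)).
  have [[x [Nx e]]|n] := classic (exists x, sdom N x /\ h x = y).
    exists x; split=> [x' Nx' e'|]; last by move=> /(_ x Nx).
    by apply: (kemb_inj kh Nx Nx'); rewrite e e'.
  exists (c (p y)); split=> // x Nx e; case: n; by exists x.
have [k hk'] := choice _ hk.
have k1 x : sdom N x -> k (h x) = x by move=> Nx; case: (hk' (h x)) => + _; exact.
have k2 y : (exists x, sdom N x /\ h x = y) \/ k y = c (p y).
  have [?|n] := classic (exists x, sdom N x /\ h x = y); [by left|right].
  by case: (hk' y) => _; apply=> x Nx e; apply: n; exists x.
have ki x y : sdom P x -> sdom P y -> k x = k y -> x = y.
  move=> Px Py; case: (k2 x) => [[x' [Nx <-]]|->]; case: (k2 y) => [[y' [Ny <-]]|->].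
  - by rewrite !k1 // => ->.
  - by rewrite k1 // => e; case: (cN (p y) I); rewrite -e.
  - by rewrite k1 // => e; case: (cN (p x) I); rewrite e.
  - by move=> e; apply: pi => //; apply: ci e.
have [P' hP'] := iso_image v ki.
exists k, P'; split=> //; exact: kemb_le_iso kh hP' k1.
Qed.

Lemma transport0 {V} (v : V) (P : structure tau V) : card_le (sdom P) (full L) ->
  exists (k : V -> L -> Prop) (P' : structure tau (L -> Prop)), iso k P P'.
Proof.
move=> [p [_ pi]]; exists (fun y => eq (p y)); apply: (iso_image v) => x y Px Py e.
by apply: pi => //; rewrite e.
Qed.

Hypothesis HA : amalgamation K.

(** [amalgamation] is about inclusions in one ambient type. Both models are moved into [V1 + V2]:
    [N1] goes to the left, while [k] sends the image of [M] in [N2] onto the image of [M] in [N1]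
    and the rest of [N2] to the right. The two copies then share one copy of [M]. *)
Lemma kemb_amalg {U V1 V2} (M : structure tau U) (N1 : structure tau V1)
    (N2 : structure tau V2) f1 f2 x0 :
  sdom M x0 -> kemb K f1 M N1 -> kemb K f2 M N2 ->
  exists W (N : structure tau W) g1 g2, [/\ kemb K g1 N1 N, kemb K g2 N2 N
    & forall x, sdom M x -> g1 (f1 x) = g2 (f2 x)].
Proof.
move=> Mx0 k1 k2.
have hk y : exists z : V1 + V2, (forall x, sdom M x -> f2 x = y -> z = inl (f1 x)) /\
    ((forall x, sdom M x -> f2 x <> y) -> z = inr y).
  have [[x [Nx e]]|n] := classic (exists x, sdom M x /\ f2 x = y).
    exists (inl (f1 x)); split=> [x' Nx' e'|]; last by move=> /(_ x Nx).
    by rewrite (kemb_inj k2 Nx Nx') // e e'.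
  exists (inr y); split=> // x Nx e; case: n; by exists x.
have [k hk'] := choice _ hk.
have k1' x : sdom M x -> k (f2 x) = inl (f1 x).
  by move=> Nx; case: (hk' (f2 x)) => + _; exact.
have k2' y : (exists x, sdom M x /\ f2 x = y) \/ k y = inr y.
  have [?|n] := classic (exists x, sdom M x /\ f2 x = y); [by left|right].
  by case: (hk' y) => _; apply=> x Nx e; apply: n; exists x.
have ki x y : sdom N2 x -> sdom N2 y -> k x = k y -> x = y.
  move=> Px Py; case: (k2' x) => [[x' [Nx <-]]|->]; case: (k2' y) => [[y' [Ny <-]]|->].
  - by rewrite !k1' // => -[e]; rewrite (kemb_inj k1 Nx Ny e).
  - by rewrite k1'.
  - by rewrite k1'.
  - by case.
have [N2' i2] := iso_image (f2 x0) ki.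
have [N1' i1] : exists N1', iso (@inl V1 V2) N1 N1'.
  by apply: (iso_image (f1 x0)) => x y _ _ [].
have e1 := kemb_comp HK k1 (kemb_iso HK (in_iso HK (kemb_in HK k1) i1) i1).
have e2 := kemb_comp HK k2 (kemb_iso HK (in_iso HK (kemb_in HK k2) i2) i2).
have [M' [iM l1]] := e1.
have {}e2 : kemb K (fun x => inl (f1 x)) M N2' by apply: kemb_ext e2.
have [M2' [iM2 l2]] := e2.
have {}l2 : leK K M' N2'.
  by apply: (le_iso HK l2 (iso_refl N2')); apply: iso_uniq iM2 iM.
have [W [N [g1 [g2 [kg1 [kg2 eg]]]]]] := HA l1 l2.
exists W, N, (fun x => g1 (inl x)), (fun y => g2 (k y)); split.
- exact: (kemb_comp HK (kemb_iso HK (le_in2 HK l1) i1) kg1).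
- exact: (kemb_comp HK (kemb_iso HK (le_in2 HK l2) i2) kg2).
- by move=> x Mx; rewrite k1' // eg //; case: iM => d _; exact: d.
Qed.

Lemma kemb_amalg_le {U V1 V2} (M : structure tau U) (N1 : structure tau V1)
    (N2 : structure tau V2) f1 f2 x0 :
  sdom M x0 -> kemb K f1 M N1 -> kemb K f2 M N2 ->
  card_le (sdom N1) (full L) -> card_le (sdom N2) (full L) ->
  exists W (N : structure tau W) g1 g2, [/\ kemb K g1 N1 N, kemb K g2 N2 N,
    forall x, sdom M x -> g1 (f1 x) = g2 (f2 x) & card_le (sdom N) (full L)].
Proof.
move=> Mx0 k1 k2 c1 c2; have [W [N [g1 [g2 [h1 h2 e]]]]] := kemb_amalg Mx0 k1 k2.
have [N0 [_ h1' h2' c]] := shrink (f1 x0) (f2 x0) h1 h2 c1 c2.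
by exists W, N0, g1, g2.
Qed.

(** At most |L| members of size |L| have a union of size |L|, which is exactly the case covered by
    the restricted chain axiom. *)
Lemma chain_upper {I U} (lt : I -> I -> Prop) (M : I -> structure tau U) :
  wo lt -> inhabited I -> card_le (full I) (full L) -> (forall i, inK K (M i)) ->
  (forall i, card_eq (sdom (M i)) (full L)) ->
  (forall i j, lt i j -> leK K (M i) (M j)) ->
  exists Md, [/\ is_union M Md, card_eq (sdom Md) (full L) & forall i, leK K (M i) Md].
Proof.
move=> wlt [i0] cI inM cM inc.
have [|Md un] := union_exists (M := M) wlt (inhabits i0).
  by move=> i j /inc /(le_sub HK).
have [dU sU] := un.
have cMd : card_le (sdom Md) (full L).
  have cU : card_le (fun x => exists i, full I i /\ sdom (M i) x) (full L).
    by apply: union_le => // i _; case: (cM i).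
  by apply: card_le_trans cU; apply: card_le_sub => x; rewrite dU => -[i ?]; exists i.
have hM : forall i, leK K (M i) Md.
  apply: (union_chain HK wlt (inhabits i0)) => //; exists i0.
  by case: (cM i0) => _; exact: card_le_trans cMd.
exists Md; split=> //; split=> //.
by case: (cM i0) => _ h; exact: card_le_trans h (le_card HK (hM i0)).
Qed.

Lemma segment_upper {I U} (lt : I -> I -> Prop) (M : I -> structure tau U) i j0 :
  wo lt -> lt j0 i -> card_le (fun j => lt j i) (full L) ->
  (forall j, lt j i -> inK K (M j)) ->
  (forall j, lt j i -> card_eq (sdom (M j)) (full L)) ->
  (forall j k, lt j k -> lt k i -> leK K (M j) (M k)) ->
  exists Md, [/\ forall x, sdom Md x <-> exists j, lt j i /\ sdom (M j) x,
    card_eq (sdom Md) (full L) & forall j, lt j i -> leK K (M j) Md].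
Proof.
move=> wlt lj ci inM cM inc.
have [||||||Md [[dU _] c h]] :=
  @chain_upper (sig (fun j => lt j i)) U (sublt lt (S := _)) (fun j => M (proj1_sig j)).
- exact: wo_sub.
- by constructor; exists j0.
- exact: card_le_trans (card_sig_le _) ci.
- by case.
- by case.
- by move=> [j lj'] [k lk] /= l; exact: inc.
exists Md; split=> // [x|j l]; last exact: (h (exist _ j l)).
rewrite dU; split=> [[[j l] /= ?]|[j [l ?]]]; [by exists j|by exists (exist _ j l)].
Qed.

End Amalgams.

(** * Orbital types and homogeneity *)

Section Types.
Variable tau : vocab.
Variable K : aclass tau.
Hypothesis HK : fragmented_AEC K.

Definition type_in {U} (N : structure tau U) (b : U) : gtriple tau U :=
  @Build_gtriple tau U U N (fun x => x) b.

Definition realizes {U} (M N : structure tau U) : Prop :=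
  forall t, valid_triple K M t -> exists b, sdom N b /\ gal_eq K M t (type_in N b).

(** Bases have size at most |n|, so this is saturation in the successor of |n|, for nonempty
    bases. *)
Definition saturated (n : Type) {U} (M : structure tau U) : Prop :=
  forall M0, leK K M0 M -> (exists x, sdom M0 x) -> card_le (sdom M0) (full n) ->
  forall t, valid_triple K M0 t -> exists b, sdom M b /\ gal_eq K M0 t (type_in M b).

(** The extension has size exactly |n| because the derivation from saturation lets it grow along a
    chain of constant size, as the restricted chain axiom requires. *)
Definition homogeneous (n : Type) {U} (M : structure tau U) : Prop :=
  forall M0, leK K M0 M -> (exists x, sdom M0 x) -> card_le (sdom M0) (full n) ->
  forall V (N0 : structure tau V) f, kemb K f M0 N0 -> card_eq (sdom N0) (full n) ->
  exists g, kemb K g N0 M /\ forall x, sdom M0 x -> g (f x) = x.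

Lemma valid_type_in {U} (M N : structure tau U) b :
  leK K M N -> sdom N b -> valid_triple K M (type_in N b).
Proof. by move=> l Nb; split=> //; exact: kemb_le. Qed.

Lemma valid_sub {U} (M0 M : structure tau U) t :
  leK K M0 M -> valid_triple K M t -> valid_triple K M0 t.
Proof. by move=> l [h ?]; split=> //; exact: (kemb_sub HK h l). Qed.

Lemma gal_sub {U} (M0 M : structure tau U) t1 t2 :
  leK K M0 M -> gal_eq K M t1 t2 -> gal_eq K M0 t1 t2.
Proof.
move=> l; elim=> {t1 t2} [t1 t2 v1 v2 [W [N [g1 [g2 [h1 [h2 [e ea]]]]]]]|t1 t2 t3 _ h _ h'].
  apply: gal_step; [exact: valid_sub v1|exact: valid_sub v2|].
  by exists W, N, g1, g2; do 2!split=> //; split=> // x /(le_dom HK l); exact: e.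
exact: gal_trans h h'.
Qed.

Lemma gal_up {U} (M N N' : structure tau U) b :
  leK K M N -> leK K N N' -> sdom N b -> gal_eq K M (type_in N b) (type_in N' b).
Proof.
move=> l l' Nb; apply: gal_step.
- exact: valid_type_in.
- apply: valid_type_in; [exact: (le_trans HK l l')|exact: (le_dom HK l' Nb)].
- exists U, N', (fun x => x), (fun x => x); split; first exact: (kemb_le l').
  by split=> //; apply: kemb_le; apply: (le_refl HK); exact: le_in2 l'.
Qed.

Variable LS : Type.
Hypothesis HL : LS_prop K LS.
Hypothesis HA : amalgamation K.

(** Amalgamation over the middle model makes [E_at] transitive on valid triples, so the transitive
    closure in [gal_eq] collapses to one common extension. *)
Lemma gal_eq_E_at {U} (M : structure tau U) t1 t2 : gal_eq K M t1 t2 -> E_at K M t1 t2.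
Proof.
suff : gal_eq K M t1 t2 ->
    [/\ valid_triple K M t1, valid_triple K M t2 & E_at K M t1 t2] by move=> h /h [].
elim=> {t1 t2} [//|t1 t2 t3 _ [v1 v2 h] _ [_ v3 h']]; split=> //.
have [W [N [g1 [g2 [k1 [k2 [e ea]]]]]]] := h.
have [W' [N' [g1' [g2' [k1' [k2' [e' ea']]]]]]] := h'.
have [_ hta] := v2; have [ht2 _] := v2.
have [X [P [p [p' [kp kp' ep]]]]] := kemb_amalg HK HA hta k2 k1'.
exists X, P, (fun x => p (g1 x)), (fun x => p' (g2' x)).
split; first exact: (kemb_comp HK k1 kp).
split; first exact: (kemb_comp HK k2' kp').
split; last by rewrite ea ep // ea'.
by move=> x Mx; rewrite e // ep ?e' //; exact: (kemb_dom HK ht2).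
Qed.

(** * Existence of saturated models *)

Section Saturation.
Variable L : Type.
Hypothesis LSL : card_le (full LS) (full L).

Let iL := above_LS_infinite HL LSL.

(** The model of [t] is cut down to a submodel [T] of size at most |L| and amalgamated with [N] over
    [M]; the amalgam is then renamed so as to extend [N] literally. The triple with [T] as its model
    is the intermediate step in the equality of types. *)
Lemma realize_one (M N : structure tau (L -> Prop)) t x0 : sdom M x0 ->
  leK K M N -> card_le (sdom N) (full L) -> valid_triple K M t ->
  exists N' b, [/\ leK K N N', card_le (sdom N') (full L), sdom N' b
                 & gal_eq K M t (type_in N' b)].
Proof.
move=> Mx0 l c v; have [kf Ta] := v.
pose A y := (exists x, sdom M x /\ tf t x = y) \/ y = ta t.
have cM := card_le_trans (le_card HK l) c.
have [|||T [lT sT cT]] := LS_below HL LSL (M := tN t) (A := A).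
- exact: kemb_in kf.
- by move=> y [[x [hx <-]]|->] //; exact: (kemb_dom HK kf hx).
- apply: (cup_le iL); first exact: card_le_trans (image_le _ _ x0) cM.
  exact: single_le (infinite_inh iL).
have Ta' : sdom T (ta t) by apply: sT; right.
have kT : kemb K (tf t) M T.
  by apply: (kemb_down HK kf lT) => x Mx; apply: sT; left; exists x.
have [W [P [g1 [g2 [k1 k2 e cP]]]]] :=
  kemb_amalg_le HK HL LSL HA Mx0 kT (kemb_le l) cT c.
have [k [P' [ik lN' ek]]] := transport HK HL LSL (g2 x0) k2 cP.
have inP' := le_in2 HK lN'.
have kP := kemb_comp HK k1 (kemb_iso HK inP' ik).
have P'b := kemb_dom HK kP Ta'.
have lMP := le_trans HK l lN'.
exists P', (k (g1 (ta t))); split=> //.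
  apply: card_le_trans cP; have [j [ij _ _]] := iso_inv (g2 x0) ik; exact: iso_card ij.
apply: (@gal_trans _ _ _ _ _ (@Build_gtriple tau _ _ T (tf t) (ta t))).
  apply: gal_step => //; exists (tV t), (tN t), (fun x => x), (fun x => x).
  split; first by apply: kemb_le; apply: le_refl => //; exact: le_in2 lT.
  by split; first exact: kemb_le.
apply: gal_step => //; first exact: valid_type_in.
exists (L -> Prop), P', (fun x => k (g1 x)), (fun x => x); split=> //.
split; first by apply: kemb_le; exact: le_refl.
by split=> // x Mx /=; rewrite e // ek //; exact: (le_dom HK l).
Qed.

Lemma card_eq_between {U} (M N : structure tau U) : leK K M N ->
  card_eq (sdom M) (full L) -> card_le (sdom N) (full L) -> card_eq (sdom N) (full L).
Proof. by move=> l [_ c] c'; split=> //; exact: card_le_trans c (le_card HK l). Qed.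

Lemma card_eq_inh {U} (M : structure tau U) : card_eq (sdom M) (full L) -> exists x, sdom M x.
Proof. by have [l] := infinite_inh iL; move=> [_ [g [h _]]]; exists (g l); exact: h. Qed.

Lemma realize_all (M : structure tau (L -> Prop)) : stable_in K L -> inK K M ->
  card_eq (sdom M) (full L) ->
  exists N, [/\ leK K M N, card_eq (sdom N) (full L) & realizes M N].
Proof.
move=> st inM cM; have [h hh] := st _ M inM cM.
have [x0 Mx0] := card_eq_inh cM.
have [lt wlt] := wo_exists L.
pose ok (_ : L) N := leK K M N /\ card_le (sdom N) (full L).
(* Stage [l] handles the types that the stability map [h] codes by [l]. Triples with one code have
   the same type, so realizing one of them is enough, and |L| stages suffice. *)
pose Q l (_ N : structure tau (L -> Prop)) := forall t, valid_triple K M t -> h t = l ->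
  exists b, sdom N b /\ gal_eq K M t (type_in N b).
have [||||f [fok finc fQ]] := @wo_chain L lt _ ok (leK K) Q wlt.
- by constructor.
- by move=> x y z; exact: le_trans.
- move=> i f hf inc.
  have [[j0 lj]|ne] := classic (exists j, lt j i); last first.
    exists M; split; last by move=> j lj; case: ne; exists j.
    by split; [exact: le_refl|case: cM].
  have [||||s [_ cs hs]] := segment_upper HK HL LSL (M := f) wlt lj.
  + exact: card_le_full (card_le_refl _).
  + by move=> j /hf [/(le_in2 HK)].
  + by move=> j /hf [l c]; exact: card_eq_between l cM c.
  + exact: inc.
  exists s; split=> //; split; last by case: cs.
  have [l _] := hf _ lj; exact: (le_trans HK l (hs _ lj)).
- move=> i s [l c].
  have [[t [vt ht]]|n] := classic (exists t, valid_triple K M t /\ h t = i); last first.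
    exists s; split=> //; first by apply: le_refl => //; exact: le_in2 l.
    by move=> t vt ht; case: n; exists t.
  have [N' [b [l' c' N'b g]]] := realize_one Mx0 l c vt.
  exists N'; split=> //; first by split=> //; exact: (le_trans HK l l').
  move=> t' vt' ht'; exists b; split=> //; apply: gal_trans g; apply: hh => //.
  by rewrite ht ht'.
have [|||||N [_ cN hN]] := chain_upper HK HL LSL (M := f) wlt.
- exact: infinite_inh.
- exact: card_le_refl.
- by move=> i; case: (fok i) => /(le_in2 HK).
- by move=> i; case: (fok i) => l c; exact: card_eq_between l cM c.
- exact: finc.
have [l0] := infinite_inh iL.
exists N; split=> //.
  have [l _] := fok l0; exact: (le_trans HK l (hN l0)).
move=> t vt; have [s [_ _ _ q]] := fQ (h t); have [b [fb g]] := q t vt erefl.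
exists b; split; first exact: (le_dom HK (hN (h t)) fb).
by apply: (gal_trans g); apply: gal_up (hN _) fb; case: (fok (h t)).
Qed.

Variable n : Type.
Hypothesis LSn : card_le (full LS) (full n).

Let inn := above_LS_infinite HL LSn.

Lemma saturated_exists : in_dom K L -> stable_in K L -> ~ card_le (full L) (full n) ->
  exists M : structure tau (L -> Prop), [/\ inK K M, card_eq (sdom M) (full L) & saturated n M].
Proof.
move=> [U1 [M1 [inM1 cM1]]] st nLn.
have [x1 M1x] := card_eq_inh cM1.
have [c1 c1'] := cM1.
have [k1 [M1' i1]] := transport0 x1 c1.
have inM1' := in_iso HK inM1 i1.
have cM1' : card_eq (sdom M1') (full L).
  split; last exact: card_le_trans c1' (iso_card i1).
  by have [j [ij _ _]] := iso_inv x1 i1; exact: card_le_trans (iso_card ij) c1.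
have [W [lt [wlt WL nWn segW]]] := wo_succ (infinite_inh inn) nLn.
have [wf tr tot] := wlt.
pose ok (_ : W) (N : structure tau (L -> Prop)) := inK K N /\ card_eq (sdom N) (full L).
pose Q (_ : W) (N N' : structure tau (L -> Prop)) := realizes N N'.
have [||||f [fok finc fQ]] := @wo_chain W lt _ ok (leK K) Q wlt.
- by constructor.
- by move=> x y z; exact: le_trans.
- move=> i f hf inc.
  have [[j0 lj]|ne] := classic (exists j, lt j i); last first.
    by exists M1'; split=> // j lj; case: ne; exists j.
  have [||||s [_ cs hs]] := segment_upper HK HL LSL (M := f) wlt lj.
  + by apply: card_le_trans WL; exact: card_le_sub.
  + by move=> j /hf [].
  + by move=> j /hf [].
  + exact: inc.
  by exists s; split=> //; split=> //; exact: (le_in2 HK (hs _ lj)).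
- move=> i s [ins cs]; have [N [l c r]] := realize_all st ins cs.
  by exists N; split=> //; split=> //; exact: (le_in2 HK l).
have iW : inhabited W.
  apply: NNPP => nW; apply: nWn; have [e] := infinite_inh inn.
  by exists (fun _ => e); split=> // x; case: nW.
have [|||M [[dM _] cM hM]] := chain_upper HK HL LSL (M := f) wlt iW WL.
- by move=> i; case: (fok i).
- by move=> i; case: (fok i).
- exact: finc.
have [i0] := iW.
exists M; split=> //; first exact: (le_in2 HK (hM i0)).
move=> M0 l0 [x0 M0x] c0 t vt.
have [k hk] : exists k, forall x, sdom M0 x -> sdom (f (k x)) x.
  apply: (@choice_on _ _ (sdom M0) (fun x i => sdom (f i) x) i0) => x /(le_dom HK l0).
  by rewrite dM.
(* W is not the union of at most |n| initial segments of size at most |n| *)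
have [i hi] : exists i, forall x, sdom M0 x -> lt (k x) i.
  apply: NNPP => ni; apply: nWn.
  apply: card_le_trans (@union_le _ W (sdom M0) (fun x i => ~ lt (k x) i) n inn c0 _).
    apply: card_le_sub => i _; apply: NNPP => h; apply: ni; exists i => x Mx.
    by apply: NNPP => h'; apply: h; exists x.
  move=> x _; apply: card_le_trans (cup_le inn (segW (k x)) (single_le (k x) (infinite_inh inn))).
  apply: card_le_sub => j nj.
  by case: (tot (k x) j) => [//|[->|?]]; [right|left].
have [s [_ fs sfi rs]] := fQ i.
have lsM := le_trans HK sfi (hM i).
have l0s : leK K M0 s.
  by apply: (le_coh HK l0 lsM) => x Mx; exact: (le_dom HK (fs _ (hi _ Mx)) (hk _ Mx)).
have [ktf Tta] := vt.
(* The stage after [s] realizes types over [s], not over [M0]. Amalgamating the model of [t] with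
   [s] over [M0] lifts [t] to a type over [s]. *)
have [X [P [g1 [g2 [kg1 kg2 e]]]]] := kemb_amalg HK HA M0x ktf (kemb_le l0s).
pose t' := @Build_gtriple tau _ _ P g2 (g1 (ta t)).
have vt' : valid_triple K s t' by split=> //; exact: (kemb_dom HK kg1 Tta).
have [b [fb g]] := rs t' vt'.
exists b; split; first exact: (le_dom HK (hM i) fb).
apply: (@gal_trans _ _ _ _ _ t').
  apply: gal_step => //; first exact: (valid_sub l0s vt').
  exists X, P, g1, (fun x => x); split=> //; split=> //.
  by apply: kemb_le; apply: le_refl => //; exact: (kemb_in HK kg1).
apply: (gal_sub l0s); apply: (gal_trans g).
exact: (gal_up sfi (hM i) fb).
Qed.

End Saturation.

(** Realizing in [M] the type of a point over a submodel identifies the two points only inside some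
    amalgam, so a map into [M] cannot simply be extended by one point. Instead triples [(A, N, g)]
    grow: [A] is strong in [M], [N] extends the copy [N0'] of [N0], and [g] embeds [A] in [N]; stage
    i puts the point [e i] of [N0'] into the range of [g]. In the end the range contains [N0'], and
    the inverse of [g] embeds it in [M]. *)
Lemma saturated_homogeneous (n : Type) {U} (M : structure tau U) :
  card_le (full LS) (full n) -> saturated n M -> homogeneous n M.
Proof.
move=> LSn sat M0 l0 [x0 M0x] c0 V N0 f kf cN0.
have inn := above_LS_infinite HL LSn.
have inM := le_in2 HK l0.
have [cN01 cN02] := cN0.
have [k0 [N0' i0]] := transport0 (f x0) cN01.
have inN0 := kemb_in HK kf.
have inN0' := in_iso HK inN0 i0.
have cN0' : card_eq (sdom N0') (full n).
  split; last exact: card_le_trans cN02 (iso_card i0).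
  by have [j [ij _ _]] := iso_inv (f x0) i0; exact: card_le_trans (iso_card ij) cN01.
have kf0 := kemb_comp HK kf (kemb_iso HK inN0' i0).
have [e [eN eS]] := enum_of_le (kemb_dom HK kf0 M0x) (proj1 cN0').
pose T := (structure tau U * structure tau (n -> Prop) * (U -> n -> Prop))%type.
pose ok (p : T) := [/\ leK K M0 p.1.1 /\ leK K p.1.1 M, card_le (sdom p.1.1) (full n),
  leK K N0' p.1.2 /\ card_le (sdom p.1.2) (full n), kemb K p.2 p.1.1 p.1.2
  & forall x, sdom M0 x -> p.2 x = k0 (f x)].
pose le (p q : T) := [/\ leK K p.1.1 q.1.1, leK K p.1.2 q.1.2
  & forall x, sdom p.1.1 x -> q.2 x = p.2 x].
(* At limits the [A] are united inside [M] by smoothness. The [N] have no bound given in advance;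
   they all have size |n|, so the restricted chain axiom provides one. *)
have ub (J : Type) (lt : J -> J -> Prop) (F : J -> T) : wo lt -> inhabited J ->
    card_le (full J) (full n) -> (forall j, ok (F j)) ->
    (forall i j, lt i j -> le (F i) (F j)) -> exists p, ok p /\ forall j, le (F j) p.
  move=> wlt iJ cJ okF inc; have [j0] := iJ.
  have incA i j : lt i j -> leK K (F i).1.1 (F j).1.1 by move=> /inc [].
  have [|||B [_ cB lB]] := chain_upper HK HL LSn (M := fun j => (F j).1.2) wlt iJ cJ.
  - by move=> i; case: (okF i) => _ _ [/(le_in2 HK)].
  - by move=> i; case: (okF i) => _ _ [l c] _ _; exact: card_eq_between l cN0' c.
  - by move=> i j /inc [].
  have [|||A [g [dA lAM lA kg hg]]] := kemb_glue (N := B) (M := M)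
      (g := fun j => (F j).2) x0 HK HK wlt iJ _ _ incA incA.
  - by move=> j; case: (okF j) => -[].
  - by move=> j; case: (okF j) => _ _ _ kj _; exact: (kemb_up HK kj (lB j)).
  - by move=> i j /inc [].
  exists (A, B, g); split; last first.
    by move=> j; split=> // x hx; rewrite /= (hg j).
  have [[lj _] _ [lNj _] _ ej] := okF j0.
  split=> //=.
  - by split=> //; exact: (le_trans HK lj (lA j0)).
  - have cU : card_le (fun x => exists i, full J i /\ sdom (F i).1.1 x) (full n).
      by apply: (union_le inn cJ) => i _; case: (okF i).
    by apply: card_le_trans cU; apply: card_le_sub => x; rewrite dA => -[i ?]; exists i.
  - by split; [exact: (le_trans HK lNj (lB j0))|case: cB].
  - by move=> x Mx; rewrite (hg j0) ?ej //; exact: (le_dom HK lj Mx).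
pose Q i (_ p : T) := exists x, sdom p.1.1 x /\ p.2 x = e i.
have [lt wlt] := wo_exists n.
have [||||F [Fok Finc FQ]] := @wo_chain n lt T (fun _ => ok) le Q wlt.
- by constructor; exact: (M0, N0', fun x => k0 (f x)).
- move=> p q r [h1 h2 h3] [h1' h2' h3']; split.
  + exact: le_trans h1 h1'.
  + exact: le_trans h2 h2'.
  + by move=> x hx; rewrite h3' ?h3 //; exact: (le_dom HK h1 hx).
- move=> i F hF inc.
  have [[j0 lj]|ne] := classic (exists j, lt j i); last first.
    exists (M0, N0', fun x => k0 (f x)); split; last by move=> j lj; case: ne; exists j.
    split=> //=; split=> //; [exact: le_refl (le_in1 HK l0)|exact: le_refl|by case: cN0'].
  have [|||||p [okp hp]] := ub (sig (fun j => lt j i)) (sublt lt (S := _)) (fun j => F (proj1_sig j)).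
  + exact: wo_sub.
  + by constructor; exists j0.
  + exact: card_le_full (card_sig_le _).
  + by move=> [j l]; exact: hF.
  + by move=> [j l] [j' l'] /= ljj; exact: inc.
  by exists p; split=> // j l; exact: (hp (exist _ j l)).
- move=> i [[A N] g] [/= [lA0 lAM] cA [lN cN] kg eg].
  pose t := @Build_gtriple tau _ _ N g (e i).
  have vt : valid_triple K A t by split=> //; exact: (le_dom HK lN (eN i)).
  have [|b [Mb /gal_eq_E_at]] := sat A lAM _ cA t vt; first by exists x0; exact: (le_dom HK lA0 M0x).
  (* [P] identifies [e i] with its realization [b]. It is cut down around [N] and a small submodel
     [A'] of [M] containing [A] and [b], then renamed so as to extend [N]. *)
  move=> [W [P [h1 [h2 [kh1 [kh2 [eh ea]]]]]]].
  have [||A' [lA' sA' cA']] := LS_below HL LSn (A := fun x => sdom A x \/ x = b) inM.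
  + by move=> x [/(le_dom HK lAM)|->].
  + exact: (cup_le inn cA (single_le b (infinite_inh inn))).
  have lAA' : leK K A A' by apply: (le_coh HK lAM lA') => x Ax; apply: sA'; left.
  have [P0 [_ kh1' kh2' cP0]] :=
    shrink HK HL LSn (k0 (f x0)) x0 kh1 (kemb_sub HK kh2 lA') cN cA'.
  have [k [P' [ik lNP' ek]]] := transport HK HL LSn (h2 x0) kh1' cP0.
  have inP' := le_in2 HK lNP'.
  exists (A', P', fun x => k (h2 x)); split.
  + split=> /=.
    * by split=> //; exact: (le_trans HK lA0 lAA').
    * exact: cA'.
    * split; first exact: (le_trans HK lN lNP').
      have [j [ij _ _]] := iso_inv (h2 x0) ik; exact: card_le_trans (iso_card ij) cP0.
    * exact: (kemb_comp HK kh2' (kemb_iso HK inP' ik)).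
    * move=> x Mx; have Ax := le_dom HK lA0 Mx.
      by rewrite -(eh x Ax) /= ek; [exact: eg|exact: (kemb_dom HK kg Ax)].
  + split=> //= x Ax; rewrite -(eh x Ax) /= ek //; exact: (kemb_dom HK kg Ax).
  + exists b; split=> /=; first by apply: sA'; right.
    by rewrite -[h2 b]ea /= ek //; exact: (le_dom HK lN (eN i)).
have [||||p [[[_ lAM] _ [lN _] kg eg] hp]] := ub n lt F wlt.
- exact: infinite_inh.
- exact: card_le_refl.
- exact: Fok.
- exact: Finc.
have [B [iB lB]] := kg.
have lNB : leK K N0' B.
  apply: (le_coh HK lN lB) => y /eS [i <-].
  have [s [_ _ _ [x [hx <-]]]] := FQ i; have [lA _ ex] := hp i.
  rewrite -(ex x hx); case: iB => d _; apply: d; exact: (le_dom HK lA hx).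
have [gi [igi e1 e2]] := iso_inv x0 iB.
have kgi : kemb K gi B M by exists p.1.1.
have kfin := kemb_comp HK (kemb_iso HK inN0' i0) (kemb_sub HK kgi lNB).
exists (fun y => gi (k0 y)); split=> // x Mx.
have [[lA0 _] _ _ _ eA] := Fok (epsilon (infinite_inh inn) (fun _ => True)).
have [lA _ ex] := hp (epsilon (infinite_inh inn) (fun _ => True)).
have hx := le_dom HK lA0 Mx.
by rewrite -(eA x Mx) -(ex x hx) e1 //; exact: (le_dom HK lA hx).
Qed.

Lemma homogeneous_iso (n : Type) {U V} (h : U -> V) (M : structure tau U) (M' : structure tau V) :
  iso h M M' -> homogeneous n M -> homogeneous n M'.
Proof.
move=> ih hom M0' l0 [y0 M0y] c0 W N0 f kf cN0.
have M'y := le_dom HK l0 M0y.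
have [x0 _] : exists x, sdom M x /\ h x = y0 by case: ih => _ [_ [s _]]; exact: s.
have [k [ik k1 k2]] := iso_inv x0 ih.
have [M0 iM0] : exists M0, iso k M0' M0.
  apply: (iso_image y0) => x y /(le_dom HK l0) hx /(le_dom HK l0) hy.
  by case: ik => _ [i _]; exact: i.
have l := le_iso HK l0 ik iM0.
have [k' [ik' e1 e2]] := iso_inv y0 iM0.
have kk' := kemb_comp HK (kemb_iso HK (le_in1 HK l0) ik') kf.
have [||g [kg eg]] := hom M0 l _ _ W N0 _ kk' cN0.
- by exists (k y0); case: iM0 => d _; exact: d.
- exact: card_le_trans (iso_card ik') c0.
exists (fun y => h (g y)); split.
  exact: (kemb_comp HK kg (kemb_iso HK (le_in2 HK l0) ih)).
move=> x Mx; have M0kx : sdom M0 (k x) by case: iM0 => d _; exact: d.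
by rewrite -{1}(e1 x Mx) eg // k2 //; exact: (le_dom HK l0).
Qed.

Lemma model_homogeneous (L n : Type) :
  card_le (full LS) (full L) -> card_le (full LS) (full n) ->
  ~ card_le (full L) (full n) -> stable_in K L -> categorical_in K L ->
  forall U (M : structure tau U), inK K M -> card_eq (sdom M) (full L) -> homogeneous n M.
Proof.
move=> LSL LSn nLn st [dom cat] U M inM cM.
have [M' [inM' cM' sat]] := saturated_exists LSL LSn dom st nLn.
have [f hf] := cat _ _ M' M inM' inM cM' cM.
exact: homogeneous_iso hf (saturated_homogeneous LSn sat).
Qed.

End Types.

(** * Two classes *)

(** The cardinal |A| + LS, a size at which Loewenheim-Skolem hulls of [A] are available. *)
Definition plus_LS (LS : Type) {U} (A : U -> Prop) : Type := (sig A + LS)%type.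

Lemma card_sum_full (X Y Z : Type) : infinite Z -> card_le (full X) (full Z) ->
  card_le (full Y) (full Z) -> card_le (full (X + Y)) (full Z).
Proof.
move=> iZ hX hY; apply: card_le_trans (sumP_le iZ hX hY).
by apply: card_le_sub => -[].
Qed.

Lemma plus_LS_ge (LS : Type) {U} (A : U -> Prop) : card_le (full LS) (full (plus_LS LS A)).
Proof. by exists inr; split=> // x y _ _ []. Qed.

Lemma le_plus_LS (LS : Type) {U} (A : U -> Prop) : inhabited LS ->
  card_le A (full (plus_LS LS A)).
Proof.
move=> [l]; apply: card_le_of_sig; first exact: (inr l).
by exists inl; split=> // x y _ _ [].
Qed.

Lemma plus_LS_mono (LS : Type) {U} (A B : U -> Prop) : (forall x, A x -> B x) ->
  card_le (full (plus_LS LS A)) (full (plus_LS LS B)).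
Proof.
move=> AB; exists (fun z => match z with
  | inl x => inl (exist _ (proj1_sig x) (AB _ (proj2_sig x))) | inr l => inr l end).
split=> // -[x|x] [y|y] _ _ // -[e]; [by congr inl; exact: sig_inj|by rewrite e].
Qed.

(** The sum is absorbed by its larger summand, which is either LS or [A], infinite in that case. *)
Lemma plus_LS_small (LS L : Type) {U} (A : U -> Prop) : infinite LS ->
  ~ card_le (full L) (full LS) -> ~ card_le (full L) A ->
  ~ card_le (full L) (full (plus_LS LS A)).
Proof.
move=> iLS h1 h2 h; case: (card_le_total_type (sig A) LS) => hc.
  apply: h1; apply: card_le_trans h _; apply: card_sum_full => //; exact: card_le_refl.
apply: h2; apply: card_le_trans h _; apply: card_le_trans (card_sig_le A).
apply: card_sum_full => //; [exact: infinite_le iLS hc|exact: card_le_refl].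
Qed.

Lemma same_below_sym (tau : vocab) (K1 K2 : aclass tau) L :
  same_below K1 K2 L -> same_below K2 K1 L.
Proof.
by move=> [h h']; split=> [U M c|U M N c c']; [rewrite h|rewrite h'].
Qed.

(** The induction hypothesis enters here through [same_below]: the hull [A1] is strong over [A] for
    [K], and has to be so for [K'] before homogeneity of [M'] can be applied to the inverse of [g]
    on its range. *)
Lemma extend_one (tau : vocab) (K K' : aclass tau) (LS n : Type) {U V}
    (M A : structure tau U) (M' : structure tau V) g a :
  fragmented_AEC K -> LS_prop K LS ->
  same_below K K' n -> card_le (full LS) (full n) -> homogeneous K' n M' ->
  leK K A M -> (exists x, sdom A x) -> card_le (sdom A) (full n) ->
  card_le (full n) (sdom M) -> sdom M a -> kemb K' g A M' ->
  exists A1 g1, [/\ leK K A A1, leK K A1 M /\ sdom A1 a, card_le (sdom A1) (full n),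
    kemb K' g1 A1 M' & forall x, sdom A x -> g1 x = g x].
Proof.
move=> HK HL [_ same] LSn hom lA [x0 Ax0] cA nM Ma [B [iB lB]].
have inn := above_LS_infinite HL LSn.
have [|||A1 [lA1 sA1 cA1]] :=
    LS_exact HL LSn (M := M) (A := fun x => sdom A x \/ x = a) _ _ _ nM.
- exact: le_in2 lA.
- by move=> x [/(le_dom HK lA)|->].
- exact: (cup_le inn cA (single_le a (infinite_inh inn))).
have lAA1 : leK K A A1 by apply: (le_coh HK lA lA1) => x Ax; apply: sA1; left.
have l' : leK K' A A1 by apply/(same _ A A1 cA (proj1 cA1)).
have [j [ij e1 e2]] := iso_inv x0 iB.
have kj : kemb K' j B A1 by exists A.
have [||g1 [kg1 eg1]] := hom B lB _ _ _ _ _ kj cA1.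
- by exists (g x0); case: iB => d _; exact: d.
- exact: card_le_trans (iso_card ij) cA.
exists A1, g1; split=> //.
- by split=> //; apply: sA1; right.
- by case: cA1.
- by move=> x Ax; rewrite -{1}(e1 x Ax) eg1 //; case: iB => d _; exact: d.
Qed.

Section TwoClasses.
Variable tau : vocab.
Variables K1 K2 : aclass tau.
Hypothesis HK1 : fragmented_AEC K1.
Hypothesis HK2 : fragmented_AEC K2.
Variable LS : Type.
Hypothesis HL1 : LS_prop K1 LS.
Hypothesis HL2 : LS_prop K2 LS.
Variable L : Type.
Hypothesis nL : ~ card_le (full L) (full LS).
Hypothesis IH : forall n : Type, card_le (full n) (full L) ->
  ~ card_le (full L) (full n) -> same_below K1 K2 n.

Let iLS : infinite LS := LS_infinite HL1.

Lemma LS_le_L : card_le (full LS) (full L).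
Proof. by case: (card_le_total_type LS L). Qed.

Let iL : infinite L := infinite_le iLS LS_le_L.

Lemma small_le {U} (A : U -> Prop) : ~ card_le (full L) A ->
  card_le (full (plus_LS LS A)) (full L).
Proof.
move=> h; have := plus_LS_small iLS nL h.
by case: (card_le_total_type (plus_LS LS A) L).
Qed.

Lemma small_same {U} (A : U -> Prop) : ~ card_le (full L) A ->
  same_below K1 K2 (plus_LS LS A).
Proof. by move=> h; apply: IH; [exact: small_le|exact: plus_LS_small]. Qed.

(** [A] serves as a gauge of size: fewer than |L| points give a bound |A| + LS below |L|, where the
    induction hypothesis holds. *)
Lemma small_leK {U} (A : U -> Prop) {V} (M N : structure tau V) : ~ card_le (full L) A ->
  card_le (sdom N) (full (plus_LS LS A)) -> leK K1 M N -> leK K2 M N.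
Proof.
move=> h c l; have [_ /(_ _ M N) [] //] := small_same h.
- exact: card_le_trans (le_card HK1 l) c.
- by move=> + _; exact.
Qed.

Lemma small_self {U} (M : structure tau U) :
  card_le (sdom M) (full (plus_LS LS (sdom M))).
Proof. apply: le_plus_LS; exact: infinite_inh. Qed.

(** * Back-and-forth between a model of [K1] and a model of [K2] *)

Section BackAndForth.
Hypothesis same_LS : same_below K1 K2 LS.
Hypothesis cat_LS : in_dom K1 LS -> categorical_in K1 LS.
Variables (U V : Type) (M : structure tau U) (N : structure tau V).
Hypothesis inM : inK K1 M.
Hypothesis inN : inK K2 N.
Hypothesis cM : card_eq (sdom M) (full L).
Hypothesis cN : card_eq (sdom N) (full L).
Hypothesis homM : forall n : Type, card_le (full LS) (full n) ->
  ~ card_le (full L) (full n) -> homogeneous K1 n M.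
Hypothesis homN : forall n : Type, card_le (full LS) (full n) ->
  ~ card_le (full L) (full n) -> homogeneous K2 n N.

(** The submodel [B] of size LS found in [N] is also a model of [K1], because the classes agree at
    LS. Categoricity of [K1] in LS then makes it isomorphic to the submodel [A] of [M], which itself
    shows that LS is in the domain. *)
Lemma common_start : exists A g, [/\ leK K1 A M, exists x, sdom A x,
  card_le (sdom A) (full LS) & kemb K2 g A N].
Proof.
have [l0] := infinite_inh iLS.
have start W (P : structure tau W) K : inK K P -> LS_prop K LS -> card_eq (sdom P) (full L) ->
    exists A, leK K A P /\ card_eq (sdom A) (full LS).
  move=> inP HL [_ cP].
  have [||||A [l _ c]] := LS_exact HL (card_le_refl _) (M := P) (A := fun _ => False).
  - by [].
  - by [].
  - by exists (fun _ => l0).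
  - exact: card_le_trans LS_le_L cP.
  by exists A.
have [A [lA cA]] := start _ _ _ inM HL1 cM.
have [B [lB cB]] := start _ _ _ inN HL2 cN.
have inA := le_in1 HK1 lA; have inB := le_in1 HK2 lB.
have [|_ cat] := cat_LS; first by exists U, A.
have inB1 : inK K1 B.
  by have [h _] := same_LS; rewrite h //; case: cB.
have [g ig] := cat _ _ A B inA inB1 cA cB.
exists A, g; split=> //; [|by case: cA|by exists B].
by case: cA => _ [h [hA _]]; exists (h l0); exact: hA.
Qed.

(** The forth step uses homogeneity of [N] in [K2]. The back step is the same lemma with the classes
    exchanged, applied to the inverse map from the image into [M]; inverting its result gives
    [g2]. *)
Lemma extend_both (n : Type) (A : structure tau U) g a b :
  card_le (full LS) (full n) -> card_le (full n) (full L) -> ~ card_le (full L) (full n) ->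
  leK K1 A M -> (exists x, sdom A x) -> card_le (sdom A) (full n) -> kemb K2 g A N ->
  sdom M a -> sdom N b ->
  exists A' g', [/\ leK K1 A A', leK K1 A' M, card_le (sdom A') (full n), kemb K2 g' A' N
    & [/\ forall x, sdom A x -> g' x = g x, sdom A' a & exists x, sdom A' x /\ g' x = b]].
Proof.
move=> LSn cnL nLn lA neA cA kg Ma Nb.
have same := IH cnL nLn.
have nM := card_le_trans cnL (proj2 cM); have nN := card_le_trans cnL (proj2 cN).
have [A1 [g1 [lAA1 [lA1 A1a] cA1 [B1 [iB1 lB1]] e1]]] :=
  extend_one HK1 HL1 same LSn (homN LSn nLn) lA neA cA nM Ma kg.
have [x0 Ax0] := neA; have A1x0 := le_dom HK1 lAA1 Ax0.
have [j [ij j1 j2]] := iso_inv x0 iB1.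
have kj : kemb K1 j B1 M by exists A1.
have gB1 x : sdom A1 x -> sdom B1 (g1 x) by case: iB1 => d _; exact: d.
have neB : exists y, sdom B1 y by exists (g1 x0); exact: gB1.
have cB1 := card_le_trans (iso_card ij) cA1.
have [B2 [h [lBB2 [lB2 B2b] cB2 [A2 [iA2 lA2]] e2]]] :=
  extend_one HK2 HL2 (same_below_sym same) LSn (homM LSn nLn) lB1 neB cB1 nN Nb kj.
have [g2 [ig2 k1 k2]] := iso_inv (g1 x0) iA2.
have hA2 y : sdom B2 y -> sdom A2 (h y) by case: iA2 => d _; exact: d.
have hg x : sdom A1 x -> h (g1 x) = x by move=> A1x; rewrite e2 ?j1 //; exact: gB1.
have gB2 x : sdom A1 x -> sdom B2 (g1 x) by move=> /gB1; exact: (le_dom HK2 lBB2).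
have lA12 : leK K1 A1 A2.
  by apply: (le_coh HK1 lA1 lA2) => x A1x; rewrite -(hg x A1x); apply/hA2/gB2.
exists A2, g2; split=> //.
- exact: (le_trans HK1 lAA1 lA12).
- exact: card_le_trans (iso_card ig2) cB2.
- by exists B2.
split.
- move=> x Ax; have A1x := le_dom HK1 lAA1 Ax.
  by rewrite -{1}(hg x A1x) k1; [exact: e1|exact: gB2].
- exact: (le_dom HK1 lA12 A1a).
- by exists (h b); split; [exact: hA2|exact: k1].
Qed.

Lemma back_and_forth : exists g, iso g M N.
Proof.
have [A0 [g0 [lA0 [x0 A0x] cA0 kg0]]] := common_start.
have [I [lt [wlt cIL cLI seg]]] := wo_initial (infinite_inh iL).
have [l0] := infinite_inh iL.
have [i0] : inhabited I by case: cLI => f _; exact: inhabits (f l0).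
have Mx0 := le_dom HK1 lA0 A0x.
have [a [aM aS]] := enum_of_le Mx0 (card_le_trans (proj1 cM) cLI).
have [b [bN bS]] := enum_of_le (kemb_dom HK2 kg0 A0x) (card_le_trans (proj1 cN) cLI).
(* Stage i may have size LS plus the number of its predecessors. The order is initial for |L|, so
   this stays below |L|, within reach of the induction hypothesis. *)
pose nu i := plus_LS LS (fun j => lt j i).
have nuL i : card_le (full (nu i)) (full L) by exact: small_le.
have nnu i : ~ card_le (full L) (full (nu i)) by exact: plus_LS_small.
have inu i : infinite (nu i) by exact: infinite_le iLS (plus_LS_ge _ _).
have [wf tr tot] := wlt.
have nuM i j : lt i j -> card_le (full (nu i)) (full (nu j)).
  by move=> l; apply: plus_LS_mono => k; move/tr; exact.
pose T := (structure tau U * (U -> V))%type.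
pose ok i (p : T) := [/\ leK K1 A0 p.1, leK K1 p.1 M, card_le (sdom p.1) (full (nu i))
  & kemb K2 p.2 p.1 N].
pose le (p q : T) := leK K1 p.1 q.1 /\ forall x, sdom p.1 x -> q.2 x = p.2 x.
pose Q i (_ p : T) := sdom p.1 (a i) /\ exists x, sdom p.1 x /\ p.2 x = b i.
(* The stages increase for [K1]; being smaller than [L] they also increase for [K2], as gluing
   [K2]-embeddings into [N] requires. *)
have inc2 i (A B : structure tau U) : card_le (sdom B) (full (nu i)) -> leK K1 A B -> leK K2 A B.
  exact: small_leK.
have [||||F [Fok Finc FQ]] := @wo_chain I lt T ok le Q wlt.
- by constructor; exact: (A0, g0).
- move=> p q r [h1 h2] [h1' h2']; split; first exact: (le_trans HK1 h1 h1').
  by move=> x hx; rewrite h2' ?h2 //; exact: (le_dom HK1 h1 hx).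
- move=> i F hF inc.
  have [[j0 lj]|ne] := classic (exists j, lt j i); last first.
    exists (A0, g0); split; last by move=> j lj; case: ne; exists j.
    split=> //=; first exact: (le_refl HK1 (le_in1 HK1 lA0)).
    exact: card_le_trans cA0 (plus_LS_ge _ _).
  have [|||||A [g [dA lAM lA kg hg]]] := @kemb_glue tau K1 K2 (sig (fun j => lt j i)) U V x0
    (sublt lt (S := _)) (fun j => (F (proj1_sig j)).1) (fun j => (F (proj1_sig j)).2) M N HK1 HK2
    (wo_sub _ wlt) (inhabits (exist _ j0 lj)).
  + by move=> [j l]; case: (hF j l).
  + by move=> [j l]; case: (hF j l).
  + by move=> [j l] [k l'] /= ljk; case: (inc j k).
  + move=> [j l] [k l'] /= ljk; case: (inc j k) => // h _.
    by apply: (inc2 k) => //; case: (hF k l').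
  + by move=> [j l] [k l'] /= ljk; case: (inc j k).
  exists (A, g); split; last first.
    by move=> j l; split; [exact: (lA (exist _ j l))|exact: (hg (exist _ j l))].
  split=> //=.
  + have [h _ _ _] := hF _ lj; exact: (le_trans HK1 h (lA (exist _ j0 lj))).
  + have cU : card_le (fun x => exists j, lt j i /\ sdom (F j).1 x) (full (nu i)).
      apply: (union_le (inu i)); first exact: le_plus_LS (infinite_inh iLS).
      by move=> j l; have [_ _ c _] := hF j l; exact: card_le_trans c (nuM _ _ l).
    by apply: card_le_trans cU; apply: card_le_sub => x; rewrite dA => -[[j l] /= ?]; exists j.
- move=> i [A g] [/= lA lAM cA kg].
  have neA : exists x, sdom A x by exists x0; exact: (le_dom HK1 lA A0x).
  have [A' [g' [lAA' lA'M cA' kg' [eg A'a hb]]]] :=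
    extend_both (plus_LS_ge _ _) (nuL i) (nnu i) lAM neA cA kg (aM i) (bN i).
  exists (A', g'); split=> //; split=> //=; exact: (le_trans HK1 lA lAA').
have Finc1 i j : lt i j -> leK K1 (F i).1 (F j).1 by move=> /Finc [].
have [||||A [g [dA lAM lA [B [iB lB]] hg]]] := kemb_glue (M := M) (N := N)
  (A := fun i => (F i).1) (g := fun i => (F i).2) x0 HK1 HK2 wlt (inhabits i0) _ _ Finc1.
- by move=> i; case: (Fok i).
- by move=> i; case: (Fok i).
- by move=> i j /Finc1; apply: (inc2 j); case: (Fok j).
- by move=> i j /Finc [].
have iA : iso (fun x => x) M A.
  apply: iso_id_sym; apply: (sub_full (le_sub HK1 lAM)) => x /aS [i <-].
  by have [_ [_ _ _ [h _]]] := FQ i; rewrite dA; exists i.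
have iN : iso (fun x => x) B N.
  apply: (sub_full (le_sub HK2 lB)) => y /bS [i <-].
  have [_ [_ _ _ [_ [x [hx <-]]]]] := FQ i.
  rewrite -(hg i x hx); case: iB => d _; apply: d; exact: (le_dom HK1 (lA i) hx).
by exists g; exact: (iso_comp (iso_comp iA iB) iN).
Qed.

End BackAndForth.

(* Alternate hulls for the two orders: both chains have the same union. *)
Lemma common_submodel {U} (N : structure tau U) (A : U -> Prop) (n : Type) :
  inK K1 N -> inK K2 N -> (forall x, A x -> sdom N x) -> card_le (full LS) (full n) ->
  card_le A (full n) ->
  exists N0, [/\ leK K1 N0 N, leK K2 N0 N, forall x, A x -> sdom N0 x
               & card_le (sdom N0) (full n)].
Proof.
move=> in1 in2 AN LSn cA; have inn := infinite_le iLS LSn.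
have natn : card_le (full nat) (full n).
  by have [e ei] := inn; exists e; split=> // i j _ _; exact: ei.
pose T := (structure tau U * structure tau U)%type.
pose ok (p : T) := [/\ leK K1 p.1 N, leK K2 p.2 N, forall x, sdom p.1 x -> sdom p.2 x,
  card_le (sdom p.2) (full n) & forall x, A x -> sdom p.1 x].
pose le (p q : T) := (forall x, sdom p.1 x -> sdom q.1 x) /\
  (forall x, sdom p.2 x -> sdom q.1 x).
have next X : (forall x, X x -> sdom N x) -> card_le X (full n) ->
    exists p, ok p /\ forall x, X x -> sdom p.1 x.
  move=> XN cX.
  have [||A1 [l1 s1 c1]] := LS_below HL1 LSn (A := fun x => A x \/ X x) in1.
  - by move=> x [/AN|/XN].
  - exact: cup_le.
  have [||A2 [l2 s2 c2]] := LS_below HL2 LSn (A := sdom A1) in2.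
  - by move=> x; exact: (le_dom HK1).
  - by [].
  by exists (A1, A2); split; [split=> //= x Ax|move=> x Xx]; apply: s1; [left|right].
have wlt : wo lt.
  split; [exact: Wf_nat.lt_wf|by move=> i j k; exact: PeanoNat.Nat.lt_trans|].
  by move=> i j; case: (PeanoNat.Nat.lt_trichotomy i j) => [|[|]]; [left|right; left|right; right].
have [||||F [Fok Finc _]] := @wo_chain nat lt T (fun _ => ok) le (fun _ _ _ => True) wlt.
- by constructor; exact: (N, N).
- by move=> p q r [h h'] [k k']; split=> x hx; [exact/k/h|exact/k/h'].
- move=> i f hf _.
  have [||p [okp hp]] := next (fun x => exists j, lt j i /\ sdom (f j).2 x).
  + by move=> x [j [/hf [_ l _ _ _] hx]]; exact: (le_dom HK2 l hx).
  + apply: (union_le inn); last by move=> j /hf [].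
    by apply: card_le_trans natn; exact: card_le_sub.
  exists p; split=> // j l; have [_ _ h _ _] := hf j l.
  by split=> x hx; apply: hp; exists j; split=> //; exact: h.
- move=> i s [l1 l2 s12 c sA].
  have [|p [okp hp]] := next (sdom s.2) _ c; first by move=> x; exact: (le_dom HK2 l2).
  by exists p; split=> //; split=> // x /s12 /hp.
have i0 : inhabited nat by constructor; exact: 0.
have inc1 i j : lt i j -> leK K1 (F i).1 (F j).1.
  move=> /Finc [h _]; have [li _ _ _ _] := Fok i; have [lj _ _ _ _] := Fok j.
  exact: (le_coh HK1 li lj).
have inc2 i j : lt i j -> leK K2 (F i).2 (F j).2.
  move=> /Finc [_ h]; have [_ li _ _ _] := Fok i; have [_ lj s _ _] := Fok j.
  by apply: (le_coh HK2 li lj) => x /h /s.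
have [|N0 un1] := union_exists (M := fun i => (F i).1) wlt i0.
  by move=> i j /inc1; exact: (le_sub HK1).
have l1 : leK K1 N0 N.
  by apply: (union_smooth HK1 wlt i0 inc1 un1) => i; case: (Fok i).
have [d1 _] := un1.
have d2 x : sdom N0 x <-> exists i, sdom (F i).2 x.
  rewrite d1; split=> -[i hi]; first by exists i; case: (Fok i) => _ _ h _ _; exact: h.
  by exists (S i); case: (Finc i (S i) (PeanoNat.Nat.lt_succ_diag_r i)) => _; exact.
have un2 : is_union (fun i => (F i).2) N0.
  split=> // i; apply: sub_sub (le_sub HK1 l1) _; last by move=> x hx; rewrite d2; exists i.
  by have [_ l _ _ _] := Fok i; exact: (le_sub HK2 l).
exists N0; split=> //.
- by apply: (union_smooth HK2 wlt i0 inc2 un2) => i; case: (Fok i).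
- by move=> x Ax; rewrite d1; exists 0; case: (Fok 0) => _ _ _ _; exact.
- have cU : card_le (fun x => exists i, full nat i /\ sdom (F i).2 x) (full n).
    by apply: (union_le inn natn) => i _; case: (Fok i).
  by apply: card_le_trans cU; apply: card_le_sub => x; rewrite d2 => -[i ?]; exists i.
Qed.

(** * Transfer of the order from [K1] to [K2] *)

Section Order.
Hypothesis models : forall U (M : structure tau U), inK K1 M ->
  card_eq (sdom M) (full L) -> inK K2 M.

Lemma le_transfer_small {U} (M N : structure tau U) : leK K1 M N ->
  card_le (sdom N) (full L) -> ~ card_le (full L) (sdom M) -> leK K2 M N.
Proof.
move=> l c nM.
have [LN|nN] := classic (card_le (full L) (sdom N)); last first.
  exact: small_leK nN (small_self N) l.
(* Hulls in [N] for [K2] require [N] to be a model of [K2]; at size |L| this is the half of the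
   induction step about models. *)
have in1 := le_in2 HK1 l; have in2 := models in1 (conj c LN).
have [|N0 [l1 l2 s cN0]] := common_submodel in1 in2 _ (plus_LS_ge LS (sdom M)) (small_self M).
  by move=> x; exact: (le_dom HK1).
exact: (le_trans HK2 (small_leK nM cN0 (le_coh HK1 l l1 s)) l2).
Qed.

Lemma le_transfer {U} (M N : structure tau U) : leK K1 M N ->
  card_le (sdom N) (full L) -> leK K2 M N.
Proof.
move=> l c; have [LM|nM] := classic (card_le (full L) (sdom M)); last first.
  exact: le_transfer_small.
have inM := le_in1 HK1 l.
have cM := card_le_trans (le_card HK1 l) c.
have [I [lt [wlt cIL cLI seg]]] := wo_initial (infinite_inh iL).
have [l0] := infinite_inh iL.
have iI : inhabited I by case: cLI => f _; exact: inhabits (f l0).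
have [x0 Mx0] : exists x, sdom M x by case: LM => f [h _]; exists (f l0); exact: h.
have [a [aM aS]] := enum_of_le Mx0 (card_le_trans cM cLI).
pose nu i := plus_LS LS (fun j => lt j i).
have inu i : infinite (nu i) by exact: infinite_le iLS (plus_LS_ge _ _).
have [wf tr tot] := wlt.
pose ok i (A : structure tau U) := leK K1 A M /\ card_le (sdom A) (full (nu i)).
have [||||F [Fok Finc FQ]] := @wo_chain I lt _ ok (leK K1) (fun i _ A => sdom A (a i)) wlt.
- by constructor.
- by move=> x y z; exact: le_trans.
- move=> i f hf inc.
  (* The bound is a hull in [M] of the union of the earlier stages, so the chain need not be
     continuous; what matters is that its total union is [M]. *)
  have [||A [lA sA cA]] := LS_below HL1 (plus_LS_ge LS (fun j => lt j i))
      (A := fun x => exists j, lt j i /\ sdom (f j) x) inM.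
  + by move=> x [j [/hf [h _] hx]]; exact: (le_dom HK1 h hx).
  + apply: (union_le (inu i)); first exact: le_plus_LS (infinite_inh iLS).
    move=> j lj; have [_ cj] := hf j lj; apply: card_le_trans cj _.
    by apply: plus_LS_mono => k; move/tr; exact.
  exists A; split=> // j lj; have [h _] := hf j lj.
  by apply: (le_coh HK1 h lA) => x hx; apply: sA; exists j.
- move=> i s [ls cs].
  have [||A [lA sA cA]] := LS_below HL1 (plus_LS_ge LS (fun j => lt j i))
      (A := fun x => sdom s x \/ x = a i) inM.
  + by move=> x [/(le_dom HK1 ls)|->].
  + exact: (cup_le (inu i) cs (single_le (a i) (infinite_inh (inu i)))).
  exists A; split=> //; last by apply: sA; right.
  by apply: (le_coh HK1 ls lA) => x hx; apply: sA; left.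
apply: (union_smooth HK2 wlt iI (M := F)).
- move=> i j lij; have [_ cj] := Fok j.
  exact: small_leK (seg j) cj (Finc _ _ lij).
- split=> [x|i]; last by have [h _] := Fok i; exact: (le_sub HK1 h).
  split=> [/aS [i <-]|[i]]; first by have [s [_ _ _ h]] := FQ i; exists i.
  by have [h _] := Fok i; exact: (le_dom HK1 h).
- move=> i; have [h ci] := Fok i; apply: le_transfer_small c _.
    exact: (le_trans HK1 h l).
  move=> Li; apply: (plus_LS_small iLS nL (seg i)); exact: card_le_trans Li ci.
Qed.

End Order.
End TwoClasses.

(** One inclusion of the induction step; exchanging the classes gives the other. Models come first,
    since the transfer of the order at size |L| relies on them. *)
Lemma same_below_step (tau : vocab) (K1 K2 : aclass tau) (LS L : Type) :
  fragmented_AEC K1 -> fragmented_AEC K2 -> LS_prop K1 LS -> LS_prop K2 LS ->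
  (forall n, in_dom K1 n -> in_dom K2 n) -> amalgamation K1 -> amalgamation K2 ->
  (forall n, in_dom K1 n -> stable_in K1 n /\ categorical_in K1 n) ->
  (forall n, in_dom K2 n -> stable_in K2 n /\ categorical_in K2 n) ->
  same_below K1 K2 LS -> ~ card_le (full L) (full LS) ->
  (forall n : Type, card_le (full n) (full L) -> ~ card_le (full L) (full n) ->
     same_below K1 K2 n) ->
  (forall U (M : structure tau U), card_le (sdom M) (full L) -> inK K1 M -> inK K2 M) /\
  (forall U (M N : structure tau U), card_le (sdom N) (full L) -> leK K1 M N -> leK K2 M N).
Proof.
move=> HK1 HK2 HL1 HL2 dom HA1 HA2 S1 S2 sLS nL IH.
have iLS := LS_infinite HL1; have LSL := LS_le_L nL.
have [l0] := infinite_inh (infinite_le iLS LSL).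
have models U (M : structure tau U) : inK K1 M -> card_eq (sdom M) (full L) -> inK K2 M.
  move=> inM cM.
  have dom1 : in_dom K1 L by exists U, M.
  (* Equality of the domains supplies a model of [K2] of size |L| to compare [M] with. *)
  have dom2 := dom _ dom1.
  have [V [N [inN cN]]] := dom2.
  have [st1 cat1] := S1 _ dom1; have [st2 cat2] := S2 _ dom2.
  have [|||g ig] := back_and_forth HK1 HK2 HL1 HL2 nL IH sLS _ inM inN cM cN.
  - by move=> /S1 [].
  - by move=> n LSn nLn; exact: (model_homogeneous HK1 HL1 HA1 LSL LSn nLn st1 cat1 inM cM).
  - by move=> n LSn nLn; exact: (model_homogeneous HK2 HL2 HA2 LSL LSn nLn st2 cat2 inN cN).
  have [x0 _] : exists x, sdom M x by case: cM => _ [f [h _]]; exists (f l0); exact: h.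
  have [j [ij _ _]] := iso_inv x0 ig.
  exact: (in_iso HK2 inN ij).
split=> [U M c inM|U M N c l]; last exact: (le_transfer HK1 HK2 HL1 HL2 nL IH models l c).
have [LM|nM] := classic (card_le (full L) (sdom M)); first exact: models.
have [h _] := small_same HL1 nL IH nM.
by rewrite -h //; exact: (small_self HL1).
Qed.

Theorem theorem3p5 (tau : vocab) (K1 K2 : aclass tau) :
  fragmented_AEC K1 -> fragmented_AEC K2 ->
  (forall L : Type, in_dom K1 L <-> in_dom K2 L) ->
  (exists L : Type, is_LS K1 L /\ is_LS K2 L) ->
  amalgamation K1 -> amalgamation K2 ->
  (forall L : Type, in_dom K1 L -> stable_in K1 L /\ categorical_in K1 L) ->
  (forall L : Type, in_dom K2 L -> stable_in K2 L /\ categorical_in K2 L) ->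
  (forall L : Type, is_LS K1 L -> same_below K1 K2 L) ->
  same_class K1 K2.
Proof.
move=> HK1 HK2 dom [LS [LS1 LS2]] HA1 HA2 S1 S2 /(_ LS LS1) sLS.
have [HL1 _] := LS1; have [HL2 _] := LS2.
have all : forall L : Type, same_below K1 K2 L.
  apply: card_induction => L IH.
  have [c|nL] := classic (card_le (full L) (full LS)).
    have [h h'] := sLS; split=> [U M cM|U M N cM cN].
      by apply: h; exact: card_le_trans cM c.
    by apply: h'; [exact: card_le_trans cM c|exact: card_le_trans cN c].
  have [h1 h1'] := same_below_step HK1 HK2 HL1 HL2 (fun n => proj1 (dom n)) HA1 HA2 S1 S2 sLS nL IH.
  have [h2 h2'] := same_below_step HK2 HK1 HL2 HL1 (fun n => proj2 (dom n)) HA2 HA1 S2 S1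
    (same_below_sym sLS) nL (fun n c nc => same_below_sym (IH n c nc)).
  by split=> [U M c|U M N cM cN]; split; [exact: h1|exact: h2|exact: h1'|exact: h2'].
(* A structure on [U] has at most |U| points, so agreement up to the cardinal of [U] settles all
   structures on [U]. *)
split=> [U M|U M N]; have [h h'] := all U.
  by apply: h; exists (fun x => x).
by apply: h'; exists (fun x => x).
Qed.
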